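(* Let $g:\mathbb{R}^2\to\mathbb{R}$ be a continuous function such that: (1) $g(x,y)\ge 0$ for all $x,y\in\mathbb{R}$; (2) for every $0<\alpha\le 1$, $M_\alpha:=\iint g^\alpha(x,y)\,dx\,dy<\infty$; (3) there is a constant $C\in\mathbb{R}$ with $g(x,y)\le e^C$ for all $x,y$; (4) for every $a>0$ the set $\{(x,y): g(x,y)\ge e^{-a}\}\subset\mathbb{R}^2$ is compact; (5) there is a $\beta\ge 0$ such that $(x,y)\mapsto \beta\log|x-y|-\log g(x,y)$ extends from $\{(x,y):x\neq y\}$ to a continuous function on $\mathbb{R}^2$. Let $k(x,y)=-\log g(x,y)$ and $I_0=\inf_{x,y\in\mathbb{R}}k(x,y)$. For each $n\ge1$ let $(x_1,\dots,x_n,y_1,\dots,y_n)$ be distributed according to the probability measure $\Pr_n$ on $\mathbb{R}^{2n}$ with density $\frac{1}{Z_n}\prod_{i,j=1}^n g(x_i,y_j)$, and let $\hat\mu_n=\frac1{n^2}\sum_{i,j=1}^n\delta_{(x_i,y_j)}$. Then the joint empirical measures $\{\hat\mu_n\}$ satisfy the large deviation principle in the scale $n^2$ with the rate function $\mathbb{I}:\mathcal{P}(\mathbb{R}^2)\to[0,\infty]$ given by $$\mathbb{I}(\mu)=\iint k(x,y)\,\nu_1(dx)\,\nu_2(dy)-I_0$$ if $\mu=\nu_1\otimes\nu_2$ is a product measure and $k$ is $\mu$-integrable, and $\mathbb{I}(\mu)=\infty$ otherwise.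
   Context: Convention: $-\log 0=\infty$. $\mathcal{P}(\mathbb{R}^2)$ is the Polish space of Borel probability measures on $\mathbb{R}^2$ with the topology of weak convergence. $Z_n=\int_{\mathbb{R}^{2n}}\prod_{i,j=1}^n g(x_i,y_j)\,dx_1\cdots dx_n\,dy_1\cdots dy_n$ is the normalizing constant. A sequence of random elements $\xi_n$ of a Polish space $E$ satisfies the large deviation principle in the scale $n^2$ with rate function $I:E\to[0,\infty]$ if $I$ is lower semicontinuous, $\limsup_{n}\frac1{n^2}\log\Pr(\xi_n\in F)\le-\inf_F I$ for every closed $F\subset E$, and $\liminf_n\frac1{n^2}\log\Pr(\xi_n\in G)\ge-\inf_G I$ for every open $G\subset E$. *)

(* Defs.v *)
From HB Require Import structures.
From mathcomp Require Import all_boot all_order all_algebra.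
From mathcomp Require Import all_classical all_reals all_analysis.

Set Implicit Arguments.
Unset Strict Implicit.
Unset Printing Implicit Defensive.

Import Order.TTheory GRing.Theory Num.Theory.
Import numFieldNormedType.Exports.

Local Open Scope classical_set_scope.
Local Open Scope ring_scope.
Local Open Scope ereal_scope.

Section lebesgue_on_tuples.
Context {R : realType}.

(* lebesgue_measure lives on measurableTypeR R, whose measurable sets are
   convertible to those of R but carry another display; this retyping makes it
   a measure on R, so that products with R * R and n.-tuple R typecheck. *)
Definition lebesgueR : set R -> \bar R := @lebesgue_measure R.

HB.instance Definition _ := isMeasure.Build _ R R lebesgueR
  (measure0 (@lebesgue_measure R)) (measure_ge0 (@lebesgue_measure R))
  (@measure_semi_sigma_additive _ _ _ (@lebesgue_measure R)).

HB.instance Definition _ := Measure_isSigmaFinite.Build _ R R lebesgueR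
  (sigma_finiteT (@lebesgue_measure R)).

Definition tuple_cons n (p : R * n.-tuple R) : n.+1.-tuple R :=
  [tuple of p.1 :: p.2].

(* Lebesgue measure on R^n; R^0 is a point of mass 1. *)
Fixpoint lebesgue_tuple n : set (n.-tuple R) -> \bar R :=
  match n with
  | 0 => @dirac _ (0.-tuple R) [tuple] R
  | m.+1 => pushforward (lebesgueR \x @lebesgue_tuple m) (@tuple_cons m)
  end.

Lemma measurable_tuple_cons n : measurable_fun setT (@tuple_cons n).
Proof. exact: measurable_cons. Qed.

Lemma lebesgue_tuple_sigma_finite_measure n :
  exists m : {sigma_finite_measure set (n.-tuple R) -> \bar R},
    m = @lebesgue_tuple n :> (set _ -> \bar R).
Proof.
elim: n => [|n [m mE]].
  by exists (@dirac _ (0.-tuple R) [tuple] R).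
set f := @tuple_cons n.
have mf : measurable_fun setT f := @measurable_tuple_cons n.
pose mu : {measure set (R * n.-tuple R)%type -> \bar R} := lebesgueR \x m.
pose nu : {measure set (n.+1.-tuple R) -> \bar R} :=
  measure_function_pushforward__canonical__measure_function_Measure mu mf.
have nuS : sigma_finite setT nu.
  have /sigma_finiteP[F [FT Fnd Foo]] := sigma_finiteT lebesgueR.
  have /sigma_finiteP[G [GT Gnd Goo]] := sigma_finiteT m.
  pose u (t : n.+1.-tuple R) : R * n.-tuple R :=
    (thead t, [tuple of behead t]).
  have fK : cancel f u.
    by move=> [x t]; rewrite /f /u /tuple_cons; congr pair; exact/val_inj.
  have mu_ : measurable_fun setT u.
    by apply/measurable_fun_pairP; split;
      [exact: measurable_tnth|exact: measurable_behead].
  exists (fun k => u @^-1` (F k `*` G k)).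
    rewrite -preimage_bigcup; apply/esym; rewrite -subTset => t _ /=.
    have [i _ Fi] : (\bigcup_k F k) (u t).1 by rewrite -FT.
    have [j _ Gj] : (\bigcup_k G k) (u t).2 by rewrite -GT.
    exists (maxn i j) => //; split.
      by move: Fi; exact/subsetPset/Fnd/leq_maxl.
    by move: Gj; exact/subsetPset/Gnd/leq_maxr.
  move=> k; have [mF Fk] := Foo k; have [mG Gk] := Goo k; split.
    by rewrite -[X in measurable X]setTI; apply: mu_ => //; exact: measurableX.
  have -> : nu (u @^-1` (F k `*` G k)) = mu (F k `*` G k).
    rewrite /nu/= /pushforward; congr (mu _).
    rewrite -comp_preimage (_ : u \o f = id) //.
    by apply/funext => z /=; exact: fK.
  by rewrite /mu/= product_measure1E// lte_mul_pinfty// ge0_fin_numE.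
pose S := Measure_isSigmaFinite.Build _ _ _ nu nuS.
pose nu' : {sigma_finite_measure set (n.+1.-tuple R) -> \bar R} :=
  HB.pack (nu : set _ -> \bar R) nu S.
by exists nu'; rewrite /= -mE.
Qed.

Let lebesgue_tuple0 n : @lebesgue_tuple n set0 = 0.
Proof. by have [m <-] := lebesgue_tuple_sigma_finite_measure n. Qed.

Let lebesgue_tuple_ge0 n A : 0 <= @lebesgue_tuple n A.
Proof. by have [m <-] := lebesgue_tuple_sigma_finite_measure n. Qed.

Let lebesgue_tuple_sigma_additive n : semi_sigma_additive (@lebesgue_tuple n).
Proof.
have [m <-] := lebesgue_tuple_sigma_finite_measure n.
exact: measure_semi_sigma_additive.
Qed.

HB.instance Definition _ n := isMeasure.Build _ _ _ (@lebesgue_tuple n)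
  (lebesgue_tuple0 n) (@lebesgue_tuple_ge0 n) (@lebesgue_tuple_sigma_additive n).

Let lebesgue_tuple_sigma_finite n : sigma_finite setT (@lebesgue_tuple n).
Proof.
have [m <-] := lebesgue_tuple_sigma_finite_measure n.
exact: sigma_finiteT.
Qed.

HB.instance Definition _ n := Measure_isSigmaFinite.Build _ _ _
  (@lebesgue_tuple n) (lebesgue_tuple_sigma_finite n).

End lebesgue_on_tuples.
Arguments lebesgueR {R}.
Arguments lebesgue_tuple {R} n.

Section weak_topology.
Context {R : realType}.

Definition bounded_continuous (f : R * R -> R) : Prop :=
  continuous f /\ exists M : R, forall z, (`|f z| <= M)%R.

(* Borel probability measures on R^2 with the topology of weak convergence:
   the coarsest one making mu |-> \int f dmu continuous for every bounded
   continuous f.  Two elements that agree on measurable sets but differ on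
   non-measurable ones are topologically indistinguishable. *)
Definition prob_plane : Type := probability (R * R)%type R.

Definition integral_bc (mu : prob_plane) :
    {ptws {f : R * R -> R | bounded_continuous f} -> R} :=
  fun f => (\int[mu : probability _ _]_z (sval f z))%R.

HB.instance Definition _ := Choice.on prob_plane.
HB.instance Definition _ :=
  Topological.copy prob_plane (initial_topology integral_bc).

End weak_topology.
Arguments prob_plane R : clear implicits.

(* a is the scale; xi n is a random element of E on the space (T n, Pr n). *)
Definition large_deviation_principle {R : realType} {E : topologicalType}
    {T : nat -> Type} (a : nat -> R) (Pr : forall n, set (T n) -> \bar R)
    (xi : forall n, T n -> E) (I : E -> \bar R) : Prop :=
  [/\ (forall x, 0 <= I x),
      lower_semicontinuous I,
      (forall F : set E, closed F ->
        limn_esup (fun n => (a n)^-1%R%:E * lne (Pr n (xi n @^-1` F)))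
          <= - ereal_inf (I @` F)) &
      (forall G : set E, open G ->
        - ereal_inf (I @` G) <=
        limn_einf (fun n => (a n)^-1%R%:E * lne (Pr n (xi n @^-1` G))))].

Section joint_empirical_measure.
Context {R : realType} (n : nat).

Definition joint_empirical (z : n.+1.-tuple R * n.+1.-tuple R)
    (A : set (R * R)) : \bar R :=
  ((n.+1%:R ^+ 2)^-1)%R%:E *
    \sum_(i < n.+1) \sum_(j < n.+1) \d_(tnth z.1 i, tnth z.2 j) A.

Variable z : n.+1.-tuple R * n.+1.-tuple R.

Let c : {nonneg R}%R := ((n.+1%:R ^+ 2 : R)^-1)%R%:nng%R.

Let mu : {measure set (R * R)%type -> \bar R} :=
  mscale c
    (msum (fun i => msum (fun j =>
      \d_(tnth z.1 (inord i), tnth z.2 (inord j))) n.+1) n.+1).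

Let joint_empiricalE : joint_empirical z = mu.
Proof.
apply/funext => A; rewrite /mu/= /mscale/= /msum; congr (_ * _).
by apply: eq_bigr => i _; apply: eq_bigr => j _; rewrite !inord_val.
Qed.

Let joint_empirical0 : joint_empirical z set0 = 0.
Proof. by rewrite joint_empiricalE. Qed.

Let joint_empirical_ge0 A : 0 <= joint_empirical z A.
Proof. by rewrite joint_empiricalE. Qed.

Let joint_empirical_sigma_additive : semi_sigma_additive (joint_empirical z).
Proof. by rewrite joint_empiricalE; exact: measure_semi_sigma_additive. Qed.

HB.instance Definition _ := isMeasure.Build _ _ _ (joint_empirical z)
  joint_empirical0 joint_empirical_ge0 joint_empirical_sigma_additive.

Let joint_empirical_setT : joint_empirical z setT = 1.
Proof.
rewrite /joint_empirical (eq_bigr (fun=> n.+1%:R%:E)) => [|i _]; last first.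
  rewrite (eq_bigr (fun=> 1%:E)) => [|j _]; last by rewrite diracT.
  by rewrite sumEFin big_const_ord iter_addr_0.
rewrite sumEFin -EFinM big_const_ord iter_addr_0.
rewrite -[(n.+1%:R *+ n.+1)%R]mulr_natr -expr2 mulVf//.
Qed.

HB.instance Definition _ := Measure_isProbability.Build _ _ _
  (joint_empirical z) joint_empirical_setT.

Definition joint_empirical_measure : prob_plane R :=
  (joint_empirical z : probability (R * R)%type R).

End joint_empirical_measure.

Section model.
Context {R : realType} (g : R * R -> R).

Definition weight n (z : n.-tuple R * n.-tuple R) : R :=
  (\prod_(i < n) \prod_(j < n) g (tnth z.1 i, tnth z.2 j))%R.

Definition partition_function n : \bar R :=
  \int[lebesgue_tuple n \x lebesgue_tuple n]_z (weight z)%:E.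

(* The law with density weight / Z_n. *)
Definition gibbs n (A : set (n.-tuple R * n.-tuple R)) : \bar R :=
  \int[lebesgue_tuple n \x lebesgue_tuple n]_(z in A)
    ((fine (partition_function n))^-1 * weight z)%R%:E.

(* lne 0 = -oo, so this takes the value +oo where g vanishes. *)
Definition neg_log (z : R * R) : \bar R := - lne (g z)%:E.

Definition inf_neg_log : \bar R := ereal_inf (range neg_log).

Definition product_integrable (mu : probability (R * R)%type R)
    (nu : probability R R * probability R R) : Prop :=
  (forall A, measurable A -> mu A = (nu.1 \x nu.2) A) /\
  mu.-integrable setT neg_log.

(* On measurable sets the factors nu.1 and nu.2 are the marginals of mu, so the
   value does not depend on the choice made by cid. *)
Definition rate (mu : prob_plane R) : \bar R :=
  match pselect (exists nu, product_integrable mu nu) with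
  | left e => let nu := sval (cid e) in
      (\int[nu.1 \x nu.2]_z neg_log z) - inf_neg_log
  | right _ => +oo
  end.

End model.

(* Main.v *)
Require Import Defs.
From HB Require Import structures.
From mathcomp Require Import all_boot all_order all_algebra.
From mathcomp Require Import all_classical all_reals all_analysis.
From mathcomp Require Import measurable_realfun ring lra.
Set Implicit Arguments.
Unset Strict Implicit.
Unset Printing Implicit Defensive.
Import Order.TTheory GRing.Theory Num.Theory.
Import numFieldNormedType.Exports.

Local Open Scope classical_set_scope.
Local Open Scope ring_scope.
Local Open Scope ereal_scope.

(** Why the theorem holds.  Write k = - log g, with infimum I_0.  The weight of
    a configuration z is exp(- n^2 E(z)), where E(z) is the integral of k
    against the empirical measure of z, which is itself a product measure; so
    the rate of the empirical measure is E(z) - I_0.  In the scale n^2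
    the factors exp(O(n)) contributed by Lebesgue measure on R^(2n) cost
    nothing, and the principle reduces to estimates up to exp(o(n^2)).

    Upper bound.  If all configurations of a set have energy at least J, the
    weight integrates over it to at most exp(- n^2 (J - o(1))).  Lebesgue
    measure being infinite, a small power of the weight is set aside to ensure
    integrability; the n factors on the diagonal of the grid suffice for that,
    the others being bounded (weight_integral_le).  Applied to the preimage of
    a set on which the rate exceeds s, this is the bound exp(- n^2 s), once the
    normalizing constant is known (gibbs_le).

    Lower bound.  Let m1 and m2 have bounded densities.  Sampling the x's from
    m1 and the y's from m2, an average over the n x n grid has variance of
    order 1/n, so with probability bounded below the empirical measure is near
    the product m of m1 and m2 and the energy is at most slightly above the
    integral of k against m.  Passing to Lebesgue measure costs exp(O(n)), whence the lower
    bound exp(- n^2 (integral of k + o(1))) (weight_integral_ge).  A general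
    product measure of finite energy is brought to this case by truncation to a
    large square (exists_truncation), then by convolution of the factors with
    uniform laws (exists_smoothing).  The second step is where the structure
    near the diagonal enters: k is a continuous function plus
    beta log 1/|x - y|, and smoothing does not increase the mean of log 1/|t| by
    more than a constant uniformly in the width, which dominates the smoothed
    energies.

    Normalization.  With J = I_0 the upper bound, and with point masses where k
    is close to I_0 the lower bound, show that Z_n is exp(- n^2 (I_0 + o(1))).

    Lower semicontinuity.  Being a product measure is a closed condition, seen
    on products of continuous test functions of one variable
    (bounded_continuous_factorization), and on product measures the integral of
    k is the supremum over n of the integrals of the bounded continuous
    functions - log (g + 1/n) (rate_lower_semicontinuous). *)

(** * Measurability on the plane *)

Section measurability.
Context {R : realType}.

Lemma exists_invn_lt (e : R) : (0 < e)%R -> exists k : nat, (k.+1%:R^-1 < e)%R.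
Proof.
move=> e0; have [k _ /(_ k (leqnn k)) ke] := near_infty_natSinv_lt (PosNum e0).
by exists k.
Qed.

Lemma open_measurable2 (U : set (R * R)) : open U -> measurable U.
Proof.
move=> oU.
pose box (t : rat * rat * nat) : set (R * R) :=
  ball (ratr t.1.1 : R) (t.2.+1%:R^-1)%R `*` ball (ratr t.1.2 : R) (t.2.+1%:R^-1)%R.
have -> : U = \bigcup_(t in [set t | box t `<=` U]) box t.
  apply/seteqP; split => [[x y] Uxy|z [t tU tz]]; last exact: tU.
  have : nbhs (x, y) U by exact: open_nbhs_nbhs.
  move=> /nbhs_ballP[e /= e0 eU].
  have [k ke] := exists_invn_lt (divr_gt0 e0 (ltr0Sn R 1)).
  have d0 : (0 < k.+1%:R^-1 :> R)%R by rewrite invr_gt0.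
  have rt (a : R) : exists q : rat, (`|a - ratr q| < k.+1%:R^-1)%R.
    have : (a - k.+1%:R^-1 < a + k.+1%:R^-1)%R by rewrite ltrD2l gtrN.
    move=> /rat_in_itvoo[q]; rewrite in_itv/= => /andP[q1 q2]; exists q.
    by rewrite ltr_distlC q1 q2.
  have [[p px] [q qy]] := (rt x, rt y).
  exists (p, q, k) => /=; last by split; rewrite /ball/= distrC.
  move=> [a b] [/= pa qb]; apply: eU; split => /=.
    rewrite /ball/= (_ : x - a = (x - ratr p) + (ratr p - a))%R; last by ring.
    by rewrite (le_lt_trans (ler_normD _ _))// (splitr e) ltrD// (lt_trans _ ke).
  rewrite /ball/= (_ : y - b = (y - ratr q) + (ratr q - b))%R; last by ring.
  by rewrite (le_lt_trans (ler_normD _ _))// (splitr e) ltrD// (lt_trans _ ke).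
rewrite bigcup_mkcond; apply: countable_bigcupT_measurable => [|t]; first exact: countableP.
by case: ifPn => // _; apply: measurableX; apply: open_measurable; exact: ball_open.
Qed.

Lemma continuous_measurable2 (f : R * R -> R) :
  continuous f -> measurable_fun setT f.
Proof.
move=> cf; apply: (measurability _ (RGenOpens.measurableE R)).
move=> _ [_ [x [y ->]] <-]; rewrite setTI; apply: open_measurable2.
by apply: open_comp => [? _|]; [exact: cf|exact: interval_open].
Qed.

Lemma measurable_lne d (T : measurableType d) (f : T -> R) :
  measurable_fun setT f -> measurable_fun setT (fun x => lne (f x)%:E).
Proof.
move=> mf; rewrite (_ : (fun _ => _) =
  (fun x => if (f x <= 0)%R then -oo else (ln (f x))%:E)); last by apply/funext.
apply: measurable_fun_if => //.
- by apply: measurable_fun_ler.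
- apply/measurable_EFinP; apply: measurable_funTS.
  by apply: measurableT_comp => //; exact: measurable_ln.
Qed.

End measurability.

(** * Comparison of integrals and of product measures *)

Section monotone_integral.
Context d (T : measurableType d) (R : realType) (mu : {measure set T -> \bar R}).

(** The integral of a nonnegative function is a supremum over the simple
    functions below it, so this comparison holds for functions and sets of any
    kind; preimages under the empirical measure are handled in this way. *)
Lemma ge0_subset_le_integral (A B : set T) (f1 f2 : T -> \bar R) :
  A `<=` B -> (forall x, A x -> 0 <= f1 x) -> (forall x, B x -> 0 <= f2 x) ->
  (forall x, A x -> f1 x <= f2 x) ->
  \int[mu]_(x in A) f1 x <= \int[mu]_(x in B) f2 x.
Proof.
move=> AB f10 f20 f12; rewrite !ge0_integralE//.
apply: le_ereal_sup => _ [h hf <-]; exists h => // x.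
apply: (le_trans (hf x)); rewrite !patchE; case: ifPn => [|_].
  by rewrite inE => Ax; rewrite mem_set; [exact: f12|exact: AB].
by case: ifPn => //; rewrite inE => Bx; exact: f20.
Qed.

End monotone_integral.

Section product_comparison.
Context d1 d2 (T1 : measurableType d1) (T2 : measurableType d2) (R : realType).
Variables m1 l1 : {sigma_finite_measure set T1 -> \bar R}.
Variables m2 l2 : {sigma_finite_measure set T2 -> \bar R}.

Lemma product_measure_le (a b : R) : (0 <= a)%R -> (0 <= b)%R ->
  (forall A, measurable A -> m1 A <= a%:E * l1 A) ->
  (forall A, measurable A -> m2 A <= b%:E * l2 A) ->
  forall A, measurable A -> (m1 \x m2) A <= (a * b)%:E * (l1 \x l2) A.
Proof.
move=> a0 b0 ml1 ml2 A mA; rewrite /product_measure1.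
have ms : measurable_fun setT (l2 \o xsection A) by exact: measurable_fun_xsection.
apply: (@le_trans _ _ (\int[m1]_x (b%:E * (l2 \o xsection A) x))).
  by apply: ge0_subset_le_integral => // x _; [rewrite mule_ge0|
    exact/ml2/measurable_xsection].
rewrite ge0_integralZl// mulrC EFinM -muleA lee_wpmul2l//.
have := @ge0_integral_mscale _ _ _ l1 setT measurableT (NngNum a0) _ ms.
move=> /(_ (fun _ _ => measure_ge0 _ _)) <-.
exact: ge0_le_measure_integral.
Qed.

End product_comparison.

Lemma emeasurable_prod d (T : measurableType d) (R : realType) (D : set T)
    (I : Type) (s : seq I) (h : I -> T -> \bar R) :
  (forall i, measurable_fun D (h i)) ->
  measurable_fun D (fun x => \prod_(i <- s) h i x).
Proof.
move=> mh; elim: s => [|i s ih].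
  rewrite [X in measurable_fun _ X](_ : _ = cst 1)//.
  by apply/funext => x; rewrite big_nil.
rewrite [X in measurable_fun _ X](_ : _ = (fun x => h i x * \prod_(j <- s) h j x)).
  exact: emeasurable_funM.
by apply/funext => x; rewrite big_cons.
Qed.

(** * Products over the coordinates of a tuple *)

Section tuple_powers.
Context {R : realType}.

(** Stated for any family of measures on tuples built by the recursion that
    lebesgue_tuple and tuple_law have in common, so as to apply to both. *)
Lemma integral_prod_tuple (m : {sigma_finite_measure set R -> \bar R})
    (M : forall n, {sigma_finite_measure set (n.-tuple R) -> \bar R}) :
  M 0%N = @dirac _ (0.-tuple R) [tuple] R :> (set _ -> _) ->
  (forall n, M n.+1 = pushforward (m \x M n) (@tuple_cons R n) :> (set _ -> _)) ->
  forall n (phi : 'I_n -> R -> \bar R),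
  (forall i, measurable_fun setT (phi i)) -> (forall i x, 0 <= phi i x) ->
  \int[M n]_t \prod_(i < n) phi i (tnth t i) = \prod_(i < n) \int[m]_x phi i x.
Proof.
move=> M0 MS; elim=> [phi mphi phi0|n ih phi mphi phi0].
  rewrite big_ord0; under eq_integral do rewrite big_ord0.
  rewrite integral_cst// mul1e; apply: etrans (congr1 (@^~ setT) M0) _.
  exact: diracT.
have mprod k (psi : 'I_k -> R -> \bar R) : (forall i, measurable_fun setT (psi i)) ->
    measurable_fun setT (fun t : k.-tuple R => \prod_(i < k) psi i (tnth t i)).
  move=> mpsi; apply: emeasurable_prod => i.
  by apply: measurableT_comp => //; exact: measurable_tnth.
have prod0 k (psi : 'I_k -> R -> \bar R) (t : k.-tuple R) : (forall i x, 0 <= psi i x) ->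
    0 <= \prod_(i < k) psi i (tnth t i).
  by move=> psi0; apply: prode_ge0 => i _; exact: psi0.
pose mu : {measure set (R * n.-tuple R)%type -> \bar R} := m \x M n.
rewrite (eq_measure_integral
  (measure_function_pushforward__canonical__measure_function_Measure mu
    (@measurable_tuple_cons R n))); last by move=> A _ _; exact: (congr1 (@^~ A) (MS n)).
rewrite ge0_integral_pushforward//; [|exact: measurable_tuple_cons|exact: mprod|
  by move=> t _; exact: prod0].
rewrite preimage_setT.
transitivity (\int[m \x M n]_z (phi ord0 z.1 *
    \prod_(i < n) phi (lift ord0 i) (tnth z.2 i))).
  apply: eq_integral => -[x t] _ /=; rewrite big_ord_recl; congr (_ * _).
  by apply: eq_bigr => i _; rewrite tnthS.
rewrite fubini_tonelli1/=.
- under eq_integral => x _.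
    rewrite /fubini_F/= ge0_integralZl//; [|exact: (mprod _ (fun i => phi (lift ord0 i)))|
      by move=> t _; exact: (prod0 _ (fun i => phi (lift ord0 i)))].
    rewrite (ih (fun i => phi (lift ord0 i)))//.
    over.
  rewrite ge0_integralZr ?big_ord_recl//.
  by apply: prode_ge0 => i _; exact: integral_ge0.
- apply: emeasurable_funM; first exact: measurableT_comp.
  exact: (measurableT_comp (mprod _ (fun i => phi (lift ord0 i)) _)).
- by move=> z; rewrite mule_ge0//; exact: (prod0 _ (fun i => phi (lift ord0 i))).
Qed.

HB.instance Definition _ n := isMeasurableFun.Build _ _ _ _ (@tuple_cons R n)
  (@measurable_tuple_cons R n).

Fixpoint tuple_law (m : probability R R) n : probability (n.-tuple R) R :=
  match n with
  | 0 => @dirac _ (0.-tuple R) [tuple] R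
  | n.+1 => distribution (m \x tuple_law m n) (@tuple_cons R n)
  end.

Lemma tuple_law_le (m : probability R R) (b : R) : (0 <= b)%R ->
  (forall A, measurable A -> m A <= b%:E * lebesgueR A) ->
  forall n A, measurable A -> tuple_law m n A <= (b ^+ n)%:E * lebesgue_tuple n A.
Proof.
move=> b0 mb; elim=> [|n ih] A mA; first by rewrite expr0 mul1e.
rewrite exprS /=; apply: product_measure_le => //; first by rewrite exprn_ge0.
by rewrite -[X in measurable X]setTI; exact: measurable_tuple_cons.
Qed.

Lemma integral_prod_tuple_law (m : probability R R) n (phi : 'I_n -> R -> \bar R) :
  (forall i, measurable_fun setT (phi i)) -> (forall i x, 0 <= phi i x) ->
  \int[tuple_law m n]_t \prod_(i < n) phi i (tnth t i) = \prod_(i < n) \int[m]_x phi i x.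
Proof. exact: (@integral_prod_tuple m (tuple_law m)). Qed.

Lemma integral_prod_lebesgue_tuple n (phi : 'I_n -> R -> \bar R) :
  (forall i, measurable_fun setT (phi i)) -> (forall i x, 0 <= phi i x) ->
  \int[lebesgue_tuple n]_t \prod_(i < n) phi i (tnth t i) =
  \prod_(i < n) \int[lebesgueR]_x phi i x.
Proof. exact: (@integral_prod_tuple lebesgueR (@lebesgue_tuple R)). Qed.

End tuple_powers.

Arguments lebesgue_tuple : simpl never.

Lemma powR_prod (R : realType) (I : Type) (s : seq I) (f : I -> R) (a : R) :
  (forall i, 0 <= f i)%R ->
  ((\prod_(i <- s) f i) `^ a = \prod_(i <- s) f i `^ a)%R.
Proof.
move=> f0; elim: s => [|i s ih]; first by rewrite !big_nil powR1.
by rewrite !big_cons powRM// ?ih// prodr_ge0.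
Qed.

(** * Upper bound on integrals of the weight *)

Section partition_bounds.
Context {R : realType} (g : R * R -> R).
Hypothesis g_meas : measurable_fun setT g.
Hypothesis g_ge0 : forall z, (0 <= g z)%R.

Lemma weight_ge0 n (z : n.-tuple R * n.-tuple R) : (0 <= weight g z)%R.
Proof. by apply: prodr_ge0 => i _; apply: prodr_ge0. Qed.

Lemma measurable_pair_tnth n (i j : 'I_n) :
  measurable_fun setT (fun z : n.-tuple R * n.-tuple R => (tnth z.1 i, tnth z.2 j)).
Proof.
apply/measurable_fun_pairP; split.
  exact: (measurableT_comp (measurable_tnth i) measurable_fst).
exact: (measurableT_comp (measurable_tnth j) measurable_snd).
Qed.

(** Matching each x with one y makes the integral a product.  This is what
    makes the weight integrable: its n factors on the diagonal of the grid are
    integrated in this way, the others are bounded by powR_weight_le. *)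
Lemma integral_prod_diag n (f : R * R -> R) : measurable_fun setT f ->
  (forall z, 0 <= f z)%R ->
  \int[lebesgue_tuple n \x lebesgue_tuple n]_z
    (\prod_(i < n) f (tnth z.1 i, tnth z.2 i))%:E =
  (\int[lebesgueR \x lebesgueR]_z (f z)%:E) ^+ n.
Proof.
move=> mf f0; rewrite fubini_tonelli1/=; last 2 first.
- apply/measurable_EFinP; apply: measurable_prod => i _.
  by apply: (measurableT_comp mf); exact: measurable_pair_tnth.
- by move=> z; rewrite lee_fin prodr_ge0.
have mF x : measurable_fun setT (fun y => (f (x, y))%:E).
  by apply/measurable_EFinP; exact: measurableT_comp.
under eq_integral => x _.
  rewrite /fubini_F/=; under eq_integral do rewrite -prodEFin.
  rewrite (integral_prod_lebesgue_tuple (phi := fun i y => (f (tnth x i, y))%:E))//=;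
    last by move=> i y; rewrite lee_fin.
  over.
rewrite (integral_prod_lebesgue_tuple
  (phi := fun _ x => \int[lebesgueR]_y (f (x, y))%:E))/=; last 2 first.
- move=> _; apply: (measurable_fun_fubini_tonelli_F (fun z => (f z)%:E)) => //.
  exact/measurable_EFinP.
- by move=> i x; apply: integral_ge0 => y _; rewrite lee_fin.
rewrite fubini_tonelli1//=; last exact/measurable_EFinP.
by rewrite big_const_ord iter_mule mule1.
Qed.

Lemma powR_weight_le n (C e : R) (z : n.+1.-tuple R * n.+1.-tuple R) :
  (0 <= C)%R -> (0 <= e)%R -> (forall z, g z <= expR C)%R ->
  (weight g z `^ e <= expR (e * C * n.+1%:R ^+ 2) *
    \prod_(i < n.+1) g (tnth z.1 i, tnth z.2 i) `^ e)%R.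
Proof.
move=> C0 e0 gC; rewrite /weight powR_prod => [|i]; last exact: prodr_ge0.
have ge1 : (1 <= expR (e * C))%R by rewrite -expR0 ler_expR mulr_ge0.
apply: (@le_trans _ _ (\prod_(i < n.+1)
    (expR (e * C) ^+ n.+1 * g (tnth z.1 i, tnth z.2 i) `^ e))%R).
  apply: ler_prod => i _; rewrite powR_ge0/= powR_prod// (bigD1 i)//= mulrC.
  rewrite ler_wpM2r ?powR_ge0//.
  apply: (@le_trans _ _ (\prod_(j < n.+1 | j != i) expR (e * C))%R).
    apply: ler_prod => j _; rewrite powR_ge0/= mulrC expRM.
    by rewrite ge0_ler_powR// nnegrE// expR_ge0.
  by rewrite prodr_const ler_weXn2l// (leq_trans (max_card _))// card_ord.
rewrite big_split/= ler_wpM2r//; first by apply: prodr_ge0 => i _; exact: powR_ge0.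
by rewrite prodr_const card_ord -exprM -expRM_natr natrM -expr2.
Qed.

(** Write the weight as the product of its powers 1 - e and e.  On F n the first
    is at most exp(- (1 - e) n^2 J), and the second integrates to at most
    exp(e C n^2) times the n-th power of the integral of g^e, which is of order
    exp(O(n)); the gap between - J and r absorbs the loss for small e.  The
    factor c is the place of the inverse of the normalizing constant. *)
Lemma weight_integral_le (C J r : R)
    (F : forall n, set (n.+1.-tuple R * n.+1.-tuple R)) :
  (forall alpha : R, (0 < alpha)%R -> (alpha <= 1)%R ->
    \int[lebesgueR \x lebesgueR]_z (g z `^ alpha)%:E < +oo) ->
  (forall z, g z <= expR C)%R ->
  (forall n z, F n z -> weight g z <= expR (- (n.+1%:R ^+ 2 * J)))%R -> (- J < r)%R ->
  \forall n \near \oo, forall c : R, (0 <= c)%R ->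
    \int[lebesgue_tuple n.+1 \x lebesgue_tuple n.+1]_(z in F n) (c * weight g z)%:E
    <= (c * expR (n.+1%:R ^+ 2 * r))%:E.
Proof.
wlog C0 : C / (0 <= C)%R.
  move=> H gp gC; apply: (H `|C|%R) => // z.
  by rewrite (le_trans (gC z))// ler_expR ler_norm.
move=> gp gC FJ Jr.
(* Half of the gap r + J pays for the loss e (C + J), the other half for the
   factor M ^+ n. *)
pose d := ((r + J) / 2)%R; have d0 : (0 < d)%R by rewrite /d; lra.
pose q := (1 + `|C + J|)%R; have q0 : (0 < q)%R by rewrite /q ltr_wpDr.
pose e := Num.min 1%R (d / q)%R.
have e0 : (0 < e)%R by rewrite lt_min ltr01 divr_gt0.
have e1 : (e <= 1)%R by rewrite ge_min lexx.
have eJ : (- (1 - e) * J + e * C <= r - d)%R.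
  have : (e * (C + J) <= d)%R.
    apply: (@le_trans _ _ (e * q)%R).
      by rewrite ler_pM2l// (le_trans (ler_norm _))// /q ler_wpDl.
    by rewrite -ler_pdivlMr// ge_min lexx orbT.
  rewrite /d; lra.
have Mfin := gp e e0 e1.
have M0 : 0 <= \int[lebesgueR \x lebesgueR]_z (g z `^ e)%:E.
  by apply: integral_ge0 => z _; rewrite lee_fin powR_ge0.
pose M := fine (\int[lebesgueR \x lebesgueR]_z (g z `^ e)%:E).
have ME : \int[lebesgueR \x lebesgueR]_z (g z `^ e)%:E = M%:E.
  by rewrite fineK// ge0_fin_numE.
have [N NM] : exists N : nat, (M / d < N%:R)%R.
  by exists (Num.truncn `|M / d|%R).+1; rewrite (le_lt_trans (ler_norm _))// truncnS_gt.
exists N => // n; rewrite [X in X -> _]/= => Nn c c0.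
have ge_powR_meas : measurable_fun setT (fun z => g z `^ e)%R.
  exact: (measurableT_comp (measurable_powR e) g_meas).
pose K := (c * expR (n.+1%:R ^+ 2 * (- (1 - e) * J + e * C)))%R.
have K0 : (0 <= K)%R by rewrite mulr_ge0// expR_ge0.
pose D (z : n.+1.-tuple R * n.+1.-tuple R) :=
  (\prod_(i < n.+1) g (tnth z.1 i, tnth z.2 i) `^ e)%R.
have D0 z : (0 <= D z)%R by apply: prodr_ge0 => i _; exact: powR_ge0.
apply: (@le_trans _ _ (\int[lebesgue_tuple n.+1 \x lebesgue_tuple n.+1]_z
    (K%:E * (D z)%:E))).
  apply: ge0_subset_le_integral => // [z _|z _|z Fz].
  - by rewrite lee_fin mulr_ge0// weight_ge0.
  - by rewrite -EFinM lee_fin mulr_ge0.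
  - rewrite -EFinM lee_fin -mulrA ler_wpM2l//.
    have -> : weight g z = (weight g z `^ (1 - e) * weight g z `^ e)%R.
      by rewrite -powRD subrK ?oner_eq0// powRr1// weight_ge0.
    rewrite mulrDr expRD -mulrA ler_pM ?powR_ge0//.
      have := FJ n z Fz; move=> /(@ge0_ler_powR _ (1 - e)%R).
      rewrite !nnegrE subr_ge0 => /(_ e1 (weight_ge0 _) (expR_ge0 _)) /le_trans; apply.
      by rewrite -expRM ler_expR; lra.
    rewrite (le_trans (powR_weight_le z C0 (ltW e0) gC))//.
    by rewrite ler_wpM2r ?D0// ler_expR mulrC.
rewrite ge0_integralZl//=; last 2 first.
- apply/measurable_EFinP; apply: measurable_prod => i _.
  by apply: (measurableT_comp ge_powR_meas); exact: measurable_pair_tnth.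
- by move=> z _; rewrite lee_fin.
rewrite (integral_prod_diag _ ge_powR_meas); last by move=> z; exact: powR_ge0.
rewrite ME -EFin_expe -EFinM lee_fin /K -mulrA ler_wpM2l//.
have : (M ^+ n.+1 <= expR (n.+1%:R ^+ 2 * d))%R.
  apply: (@le_trans _ _ (expR M ^+ n.+1)%R).
    by rewrite lerXn2r ?nnegrE ?expR_ge0// ?fine_ge0// (le_trans _ (expR_ge1Dx _))// ler_wpDl.
  rewrite -expRM_natl ler_expR expr2 -mulrA ler_pM2l ?ltr0n//.
  rewrite -ler_pdivrMr// ltW// (lt_le_trans NM)// ler_nat.
  by rewrite (leq_trans Nn).
move=> /(ler_wpM2l (expR_ge0 (n.+1%:R ^+ 2 * (- (1 - e) * J + e * C)))) /le_trans.
apply; rewrite -expRD ler_expR -mulrDr ler_wpM2l ?sqr_ge0//.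
lra.
Qed.

End partition_bounds.

(** * Averages over a grid of independent samples *)

Lemma integral_cst_prob d (T : measurableType d) (R : realType) (P : probability T R) (r : R) :
  \int[P]_x (cst r%:E) x = r%:E.
Proof. by rewrite integral_cst//= probability_setT mule1. Qed.

Section sampling.
Context {R : realType} (m1 m2 : probability R R).

Definition average n (f : R * R -> R) (z : n.-tuple R * n.-tuple R) : R :=
  ((n%:R ^+ 2)^-1 * \sum_(p : 'I_n * 'I_n) f (tnth z.1 p.1, tnth z.2 p.2))%R.

Lemma measurable_average n (f : R * R -> R) :
  measurable_fun setT f -> measurable_fun setT (@average n f).
Proof.
move=> mf; apply: measurable_funM => //; apply: measurable_sum => p.
by apply: (measurableT_comp mf); exact: measurable_pair_tnth.
Qed.

Lemma integral_tnth (m : probability R R) n (i : 'I_n) (f : R -> \bar R) :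
  measurable_fun setT f -> (forall x, 0 <= f x) ->
  \int[tuple_law m n]_t f (tnth t i) = \int[m]_x f x.
Proof.
move=> mf f0; pose phi (j : 'I_n) : R -> \bar R := if j == i then f else cst 1.
transitivity (\int[tuple_law m n]_t \prod_(j < n) phi j (tnth t j)).
  apply: eq_integral => t _; rewrite (bigD1 i)//= /phi eqxx big1 ?mule1//.
  by move=> j /negbTE ->.
rewrite integral_prod_tuple_law => [||j x]; last by rewrite /phi; case: ifP.
  rewrite (bigD1 i)//= {1}/phi eqxx big1 ?mule1// => j /negbTE ji.
  rewrite /phi ji; rewrite integral_cst//= mul1e; exact: probability_setT.
by move=> j; rewrite /phi; case: ifP.
Qed.

Lemma integral_tnth2 (m : probability R R) n (i j : 'I_n) (f h : R -> \bar R) :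
  i != j -> measurable_fun setT f -> (forall x, 0 <= f x) ->
  measurable_fun setT h -> (forall x, 0 <= h x) ->
  \int[tuple_law m n]_t (f (tnth t i) * h (tnth t j)) =
  \int[m]_x f x * \int[m]_x h x.
Proof.
move=> ij mf f0 mh h0; have /negbTE ji : j != i by rewrite eq_sym.
pose phi (k : 'I_n) : R -> \bar R :=
  if k == i then f else if k == j then h else cst 1.
transitivity (\int[tuple_law m n]_t \prod_(k < n) phi k (tnth t k)).
  apply: eq_integral => t _; rewrite (bigD1 i)//= (bigD1 j) 1?eq_sym//=.
  rewrite /phi eqxx ji eqxx big1 ?mule1//.
  by move=> k /andP[/negbTE -> /negbTE ->].
rewrite integral_prod_tuple_law => [||k x]; last by rewrite /phi; case: ifP => //; case: ifP.
  rewrite (bigD1 i)//= (bigD1 j) 1?eq_sym//= /phi eqxx ji eqxx big1 ?mule1//.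
  move=> k /andP[/negbTE -> /negbTE ->].
  rewrite integral_cst//= mul1e; exact: probability_setT.
by move=> k; rewrite /phi; case: ifP => //; case: ifP.
Qed.

Local Notation Q n := (tuple_law m1 n \x tuple_law m2 n).

Lemma integral_pair_tnth n (i j : 'I_n) (f : R * R -> \bar R) :
  measurable_fun setT f -> (forall z, 0 <= f z) ->
  \int[Q n]_z f (tnth z.1 i, tnth z.2 j) = \int[m1 \x m2]_z f z.
Proof.
move=> mf f0; rewrite fubini_tonelli1//; last first.
  by apply: (measurableT_comp mf); exact: measurable_pair_tnth.
rewrite fubini_tonelli1// /fubini_F.
under eq_integral => x _.
  rewrite (@integral_tnth m2 n j (fun y => f (tnth x i, y)))//;
    last by apply: measurableT_comp.
  over.
rewrite (@integral_tnth m1 n i (fun x => \int[m2]_y f (x, y)))//.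
  exact: measurable_fun_fubini_tonelli_F.
by move=> x; exact: integral_ge0.
Qed.

(** Two cells of the grid lying in different rows and columns are sampled
    independently. *)
Lemma integral_pair_tnth2 n (i j k l : 'I_n) (f : R * R -> \bar R) :
  i != k -> j != l -> measurable_fun setT f -> (forall z, 0 <= f z) ->
  \int[Q n]_z (f (tnth z.1 i, tnth z.2 j) * f (tnth z.1 k, tnth z.2 l)) =
  (\int[m1 \x m2]_z f z) ^+ 2.
Proof.
move=> ik jl mf f0; rewrite fubini_tonelli1//; last 2 first.
- by apply: emeasurable_funM; apply: (measurableT_comp mf); exact: measurable_pair_tnth.
- by move=> z; rewrite mule_ge0.
rewrite /fubini_F/=.
have mfx x : measurable_fun setT (fun y => f (x, y)) by exact: measurableT_comp.
under eq_integral => x _.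
  rewrite (@integral_tnth2 m2 n j l (fun y => f (tnth x i, y)) (fun y => f (tnth x k, y)))//.
  over.
have mF : measurable_fun setT (fun x => \int[m2]_y f (x, y)).
  exact: measurable_fun_fubini_tonelli_F.
have F0 x : 0 <= \int[m2]_y f (x, y) by exact: integral_ge0.
rewrite (@integral_tnth2 m1 n i k (fun x => \int[m2]_y f (x, y)) (fun x => \int[m2]_y f (x, y)))//.
by rewrite fubini_tonelli1// expe2.
Qed.

Lemma sum_shared_coordinates n :
  (\sum_(p : 'I_n * 'I_n) \sum_(q : 'I_n * 'I_n) ((p.1 == q.1) + (p.2 == q.2)) =
   2 * n ^ 3)%N.
Proof.
have row (i : 'I_n) : (\sum_(q : 'I_n * 'I_n) (i == q.1) = n)%N.
  rewrite -(pair_bigA _ (fun a b : 'I_n => nat_of_bool (i == a)))/= (bigD1 i)//= [X in (_ + X)%N]big1.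
    by rewrite eqxx sum_nat_const card_ord muln1 addn0.
  by move=> j /negbTE ji; rewrite big1// => k _; rewrite eq_sym ji.
have col (i : 'I_n) : (\sum_(q : 'I_n * 'I_n) (i == q.2) = n)%N.
  rewrite -(pair_bigA _ (fun a b : 'I_n => nat_of_bool (i == b)))/=.
  under eq_bigr => a _.
    rewrite (bigD1 i)//= big1 ?addn0 ?eqxx; last first.
      by move=> j /negbTE ji; rewrite eq_sym ji.
    over.
  by rewrite sum_nat_const card_ord muln1.
under eq_bigr => p _ do rewrite big_split/= row col.
by rewrite sum_nat_const card_prod card_ord addnn -mul2n mulnCA !expnS expn0 muln1 -!mulnA.
Qed.

(** Among the pairs of cells of an n x n grid, only 2 n^3 share a row or a
    column, so that averages over the grid concentrate. *)
Lemma variance_average_le n (f : R * R -> R) (M a : R) :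
  measurable_fun setT f -> (forall z, 0 <= f z <= M)%R ->
  \int[m1 \x m2]_z (f z)%:E = a%:E ->
  \int[Q n.+1]_z ((average f z - a) ^+ 2)%:E <= (2 * M ^+ 2 / n.+1%:R)%:E.
Proof.
move=> mf fM fa.
have f0 z : (0 <= f z)%R by have /andP[] := fM z.
have M0 : (0 <= M)%R by have /andP[/le_trans] := fM (0%R, 0%R); apply.
have a0 : (0 <= a)%R.
  by rewrite -lee_fin -fa; apply: integral_ge0 => z _; rewrite lee_fin.
set N : R := n.+1%:R; have N0 : (0 < N)%R by rewrite ltr0n.
have NN0 : (0 <= (N ^+ 2)^-1)%R by rewrite invr_ge0 sqr_ge0.
pose F p (z : n.+1.-tuple R * n.+1.-tuple R) := f (tnth z.1 p.1, tnth z.2 p.2).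
have mF p : measurable_fun setT (F p).
  by apply: (measurableT_comp mf); exact: measurable_pair_tnth.
have F0 p z : (0 <= F p z)%R by exact: f0.
have mEf : measurable_fun setT (fun z => (f z)%:E) by exact/measurable_EFinP.
have mavg := @measurable_average n.+1 f mf.
have avg0 (z : n.+1.-tuple R * n.+1.-tuple R) : (0 <= average f z)%R.
  by rewrite /average mulr_ge0// sumr_ge0.
have cstQ r : \int[Q n.+1]_z (cst r%:E) z = r%:E.
  exact: (@integral_cst_prob _ _ _ (Q n.+1)).
have avgE : \int[Q n.+1]_z (average f z)%:E = a%:E.
  rewrite (eq_integral (fun z => ((N ^+ 2)^-1)%:E * \sum_p (F p z)%:E)); last first.
    by move=> z _; rewrite sumEFin.
  rewrite ge0_integralZl//; last 2 first.
  - by apply: emeasurable_sum => p; exact/measurable_EFinP.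
  - by move=> z _; apply: sume_ge0 => p _; rewrite lee_fin.
  rewrite ge0_integral_sum//; last 2 first.
  - by move=> p; exact/measurable_EFinP.
  - by move=> p z _; rewrite lee_fin.
  under eq_bigr => p _.
    rewrite (@integral_pair_tnth n.+1 p.1 p.2 (fun z => (f z)%:E))// fa.
    over.
  rewrite sumEFin -EFinM sumr_const card_prod card_ord -mulr_natl natrM -expr2 mulrA.
  by rewrite mulVf ?mul1r// expf_neq0// gt_eqF.
(* Cells sharing a row or a column contribute at most M^2, the others exactly
   a^2. *)
have FF p q : \int[Q n.+1]_z (F p z * F q z)%:E <=
    (a ^+ 2 + ((p.1 == q.1) + (p.2 == q.2))%N%:R * M ^+ 2)%:E.
  have [pq|/norP[pq1 pq2]] := boolP ((p.1 == q.1) || (p.2 == q.2)).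
    apply: (@le_trans _ _ (\int[Q n.+1]_z (cst (M ^+ 2)%:E) z)).
      apply: ge0_subset_le_integral => // z _; rewrite lee_fin ?mulr_ge0 ?sqr_ge0//.
      by rewrite expr2 ler_pM//; have /andP[] := fM (tnth z.1 p.1, tnth z.2 p.2) => //;
        have /andP[] := fM (tnth z.1 q.1, tnth z.2 q.2).
    rewrite cstQ lee_fin.
    rewrite ler_wpDl ?sqr_ge0// ler_peMl ?sqr_ge0// ler1n.
    by case/orP: pq => ->; case: (_ == _).
  rewrite (negbTE pq1) (negbTE pq2) mul0r addr0 EFin_expe -fa.
  rewrite -(@integral_pair_tnth2 n.+1 p.1 p.2 q.1 q.2 (fun z => (f z)%:E))//.
have avg2 : \int[Q n.+1]_z (average f z ^+ 2)%:E <= (a ^+ 2 + 2 * M ^+ 2 / N)%:E.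
  rewrite (eq_integral (fun z => ((N ^+ 4)^-1)%:E *
      \sum_p \sum_q (F p z * F q z)%:E)); last first.
    move=> z _; under eq_bigr do rewrite sumEFin.
    rewrite sumEFin -EFinM; congr EFin; rewrite /average -/N exprMn exprVn -exprM.
    by congr (_ * _)%R; rewrite expr2 mulr_suml; apply: eq_bigr => p _; rewrite mulr_sumr.
  rewrite ge0_integralZl//; last 3 first.
  - apply: emeasurable_sum => p; apply: emeasurable_sum => q; apply/measurable_EFinP.
    exact: measurable_funM.
  - by move=> z _; apply: sume_ge0 => p _; apply: sume_ge0 => q _; rewrite lee_fin mulr_ge0.
  - by rewrite lee_fin invr_ge0 exprn_ge0// ltW.
  have mFF p q : measurable_fun setT (fun z => (F p z * F q z)%:E).
    by apply/measurable_EFinP; exact: measurable_funM.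
  rewrite ge0_integral_sum//; last 2 first.
  - by move=> p; exact: emeasurable_sum.
  - by move=> p z _; apply: sume_ge0 => q _; rewrite lee_fin mulr_ge0.
  under eq_bigr => p _.
    rewrite ge0_integral_sum//; last by move=> q z _; rewrite lee_fin mulr_ge0.
    over.
  rewrite /=.
  apply: (@le_trans _ _ (((N ^+ 4)^-1)%:E * \sum_(p : 'I_n.+1 * 'I_n.+1)
    \sum_(q : 'I_n.+1 * 'I_n.+1)
      (a ^+ 2 + ((p.1 == q.1) + (p.2 == q.2))%N%:R * M ^+ 2)%:E)).
    apply: lee_wpmul2l; first by rewrite lee_fin invr_ge0 exprn_ge0// ltW.
    by apply: lee_sum => p _; apply: lee_sum => q _; exact: FF.
  under eq_bigr do rewrite sumEFin.
  rewrite sumEFin -EFinM lee_fin.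
  under eq_bigr do rewrite big_split/= -[X in (_ + X)%R]mulr_suml -natr_sum sumr_const card_prod card_ord.
  rewrite big_split/= -[X in (_ + X)%R]mulr_suml -natr_sum sum_shared_coordinates sumr_const.
  rewrite card_prod card_ord -mulrnA -[X in (X + _)%R]mulr_natl.
  rewrite (_ : (2 * n.+1 ^ 3)%:R = 2 * N ^+ 3)%R; last by rewrite natrM natrX.
  rewrite !natrM -/N.
  rewrite le_eqVlt; apply/orP; left; apply/eqP; field.
  by rewrite gt_eqF.
have mdev : measurable_fun setT (fun z : n.+1.-tuple R * n.+1.-tuple R =>
    ((average f z - a) ^+ 2)%:E).
  by apply/measurable_EFinP; apply: measurable_funX; exact: measurable_funB.
have m2avg : measurable_fun setT (fun z : n.+1.-tuple R * n.+1.-tuple R =>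
    (2 * a)%:E * (average f z)%:E).
  by apply: emeasurable_funM => //; exact/measurable_EFinP.
have E1 : \int[Q n.+1]_z ((2 * a)%:E * (average f z)%:E) = (2 * a * a)%:E.
  rewrite ge0_integralZl//; last 3 first.
  - exact/measurable_EFinP.
  - by move=> z _; rewrite lee_fin.
  - by rewrite lee_fin mulr_ge0.
  by rewrite avgE.
rewrite -(@leeD2rE _ (2 * a * a)%:E)// -{1}E1 -ge0_integralD//; last 2 first.
- by move=> z _; rewrite lee_fin sqr_ge0.
- by move=> z _; rewrite -EFinM lee_fin; apply: mulr_ge0; [exact: mulr_ge0|exact: avg0].
rewrite (eq_integral (fun z : n.+1.-tuple R * n.+1.-tuple R =>
  (average f z ^+ 2)%:E + (a ^+ 2)%:E)); last first.
  by move=> z _; rewrite -EFinM -!EFinD; congr EFin; ring.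
rewrite ge0_integralD//; last 3 first.
- by move=> z _; rewrite lee_fin sqr_ge0.
- by apply/measurable_EFinP; exact: measurable_funX.
- by move=> z _; rewrite lee_fin sqr_ge0.
rewrite cstQ.
apply: (le_trans (leeD2r _ avg2)); rewrite -!EFinD lee_fin le_eqVlt.
by apply/orP; left; apply/eqP; ring.
Qed.

End sampling.

Lemma bounded_integrable d (T : measurableType d) (R : realType) (P : probability T R)
    (f : T -> R) (M : R) :
  measurable_fun setT f -> (forall z, `|f z| <= M)%R -> P.-integrable setT (EFin \o f).
Proof.
move=> mf fM; apply: measurable_bounded_integrable => //.
  by rewrite /=; apply: le_lt_trans (probability_le1 _ measurableT) _ => //; rewrite ltry.
by exists M; split=> [|x Mx z _]; [exact: num_real|exact: (le_trans (fM z) (ltW Mx))].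
Qed.

Section law_of_large_numbers.
Context {R : realType} (m1 m2 : probability R R).
Local Notation Q n := (tuple_law m1 n \x tuple_law m2 n).

(** Chebyshev's inequality; f is shifted by M to apply variance_average_le, which
    is about nonnegative functions. *)
Lemma average_deviation_le n (f : R * R -> R) (M a e : R) :
  measurable_fun setT f -> (forall z, `|f z| <= M)%R ->
  \int[m1 \x m2]_z (f z)%:E = a%:E -> (0 < e)%R ->
  Q n.+1 [set z | (e <= `|average f z - a|)%R] <= (8 * M ^+ 2 / e ^+ 2 / n.+1%:R)%:E.
Proof.
move=> mf fM fa e0; pose f' z := (f z + M)%R.
have mf' : measurable_fun setT f' by exact: measurable_funD.
have fM' z : (0 <= f' z <= 2 * M)%R.
  by have := fM z; rewrite ler_norml /f' => /andP[? ?]; apply/andP; split; lra.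
have f'a : \int[m1 \x m2]_z (f' z)%:E = (a + M)%:E.
  rewrite (eq_integral (fun z => (f z)%:E + (cst M%:E) z))//.
  rewrite integralD//=; last 2 first.
  - exact: (bounded_integrable (m1 \x m2) mf fM).
  - exact: (@bounded_integrable _ _ R (m1 \x m2) (cst M) `|M|%R).
  by rewrite fa (integral_cst_prob (m1 \x m2)).
have avgD (z : n.+1.-tuple R * n.+1.-tuple R) : average f' z = (average f z + M)%R.
  rewrite /average big_split/= mulrDr; congr (_ + _)%R.
  rewrite sumr_const card_prod card_ord -[X in (_ * X)%R]mulr_natl natrM -expr2 mulrA.
  by rewrite mulVf ?mul1r ?expf_neq0 ?pnatr_eq0//.
have mavg : measurable_fun setT (fun z : n.+1.-tuple R * n.+1.-tuple R =>
    ((average f' z - (a + M)) ^+ 2)%:E).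
  apply/measurable_EFinP; apply: measurable_funX; apply: measurable_funB => //.
  exact: measurable_average.
have := @le_integral_abse _ _ _ (Q n.+1) setT measurableT _ _ mavg (exprn_gt0 2 e0).
under eq_integral => z _ do rewrite gee0_abs ?lee_fin ?sqr_ge0//.
move=> /le_trans/(_ (variance_average_le n mf' fM' f'a)).
rewrite setTI (_ : [set _ | _] = [set z | (e <= `|average f z - a|)%R]); last first.
  have e_nneg : e \is Num.nneg by rewrite nnegrE ltW.
  by apply/seteqP; split => z /=;
    rewrite avgD opprD addrACA subrr addr0 lee_fin normrX ler_sqr// nnegrE.
have e20 : (0 < e ^+ 2)%R by exact: exprn_gt0.
move=> h; rewrite -(@lee_pmul2l _ (e ^+ 2)%:E)// ?lte_fin//.
apply: (le_trans h); rewrite -EFinM lee_fin le_eqVlt; apply/orP; left; apply/eqP.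
have : n.+1%:R != 0%R :> R by rewrite pnatr_eq0.
have : e != 0%R by rewrite gt_eqF.
by move: n.+1%:R => N; move=> eN0 N0; field; rewrite N0 eN0.
Qed.

Lemma measurable_average_near n (f : R * R -> R) (a e : R) : measurable_fun setT f ->
  measurable [set z : n.+1.-tuple R * n.+1.-tuple R | (`|average f z - a| < e)%R].
Proof.
move=> mf; rewrite (_ : [set _ | _] = (fun z : n.+1.-tuple R * n.+1.-tuple R =>
  `|average f z - a|)%R @^-1` `]-oo, e[); last first.
  by apply/seteqP; split => z /=; rewrite in_itv.
rewrite -[X in measurable X]setTI.
have mX : measurable_fun setT (fun z : n.+1.-tuple R * n.+1.-tuple R =>
    `|average f z - a|)%R.
  apply: (measurableT_comp (@normr_measurable _ setT)).
  by apply: measurable_funB => //; exact: measurable_average.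
exact: mX.
Qed.

Lemma measurable_averages_near n k (f : nat -> R * R -> R) (a : nat -> R) (e : R) :
  (forall i, measurable_fun setT (f i)) ->
  measurable [set z : n.+1.-tuple R * n.+1.-tuple R |
    forall i, (i < k)%N -> (`|average (f i) z - a i| < e)%R].
Proof.
move=> mf; rewrite (_ : [set _ | _] = \bigcap_i [set z | (i < k)%N ->
  (`|average (f i) z - a i| < e)%R]); last first.
  by apply/seteqP; split => z /= h i; [move=> _; exact: h|exact: h].
apply: bigcapT_measurable => i; case: (ltnP i k) => ij.
  rewrite (_ : [set _ | _] = [set z | (`|average (f i) z - a i| < e)%R]).
    exact: measurable_average_near.
  by apply/seteqP; split => z /=; [exact|move=> + _].
rewrite (_ : [set _ | _] = setT); first exact: measurableT.
by apply/seteqP; split.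
Qed.

Lemma average_near_mean (k : nat) (f : nat -> R * R -> R) (a : nat -> R) (e eta : R) :
  (forall i, measurable_fun setT (f i)) ->
  (forall i, exists M : R, forall z, `|f i z| <= M)%R ->
  (forall i, \int[m1 \x m2]_z (f i z)%:E = (a i)%:E) -> (0 < e)%R -> (0 < eta)%R ->
  \forall n \near \oo,
    Q n.+1 (~` [set z | forall i, (i < k)%N -> (`|average (f i) z - a i| < e)%R]) <= eta%:E.
Proof.
move=> mf fM fa e0; elim: k eta => [|k ih] eta eta0.
  apply: nearW => n; rewrite (_ : [set _ | _] = setT) ?setCT ?measure0 ?lee_fin 1?ltW//.
  by apply/seteqP; split.
have [M kM] := fM k.
have mdev n i : measurable [set z : n.+1.-tuple R * n.+1.-tuple R |
    (`|average (f i) z - a i| < e)%R] by exact: measurable_average_near.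
have mgood n j := @measurable_averages_near n j f a e mf.
have eta20 : (0 < eta / 2)%R by rewrite divr_gt0.
have := ih _ eta20; apply: filterS2 (nbhs_infty_ger (8 * M ^+ 2 / e ^+ 2 / (eta / 2)))%R => n.
move=> Mn good.
apply: (@le_trans _ _ (Q n.+1 ((~` [set z | forall i, (i < k)%N ->
    (`|average (f i) z - a i| < e)%R]) `|` [set z | (e <= `|average (f k) z - a k|)%R]))).
  apply: le_measure; rewrite ?inE.
  - exact: measurableC (mgood n k.+1).
  - apply: measurableU; first exact: measurableC (mgood n k).
    rewrite (_ : [set _ | _] = ~` [set z | (`|average (f k) z - a k| < e)%R]).
      exact: measurableC (mdev n k).
    by apply/seteqP; split => z /=; rewrite leNgt => /negP.
  - move=> z /= /existsNP[i /not_implyP[ik dev]].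
    move: ik; rewrite ltnS leq_eqVlt => /predU1P[<-|ik].
      by right; rewrite leNgt; exact/negP.
    by left => /(_ i ik).
apply: le_trans (measureU2 _ _ _) _.
- exact: measurableC (mgood n k).
- rewrite (_ : [set _ | _] = ~` [set z | (`|average (f k) z - a k| < e)%R]).
    exact: measurableC (mdev n k).
  by apply/seteqP; split => z /=; rewrite leNgt => /negP.
rewrite (_ : eta%:E = (eta / 2)%:E + (eta / 2)%:E); last by rewrite -EFinD -splitr.
apply: leeD; first exact: good.
apply: (le_trans (average_deviation_le n (mf k) kM (fa k) e0)).
rewrite lee_fin ler_pdivrMr ?ltr0n// [leRHS]mulrC -ler_pdivrMr//.
by rewrite (le_trans Mn)// ler_nat.
Qed.

End law_of_large_numbers.

(** * Lower bound on integrals of the weight *)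

Section weight_lower_bound.
Context {R : realType} (g : R * R -> R).
Hypothesis g_meas : measurable_fun setT g.
Hypothesis g_ge0 : forall z, (0 <= g z)%R.
Variable C : R.
Hypothesis g_le : forall z, (g z <= expR C)%R.

Lemma measurable_neg_log : measurable_fun setT (neg_log g).
Proof. by apply: measurableT_comp => //; exact: measurable_lne. Qed.

Lemma neg_log_ge z : (- C)%:E <= neg_log g z.
Proof.
rewrite /neg_log EFinN leeN2 /lne; case: (leP (g z) 0%R) => g0; first exact: leNye.
by rewrite lee_fin -ler_expR lnK.
Qed.

Lemma neg_log_shift_ge0 z : 0 <= neg_log g z + C%:E.
Proof. by rewrite -leeBlDr// sub0e -EFinN neg_log_ge. Qed.

Lemma measurable_neg_log_shift : measurable_fun setT (fun z => neg_log g z + C%:E).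
Proof. by apply: emeasurable_funD => //; exact: measurable_neg_log. Qed.

Lemma neg_log_fin z : neg_log g z < +oo ->
  (0 < g z)%R /\ neg_log g z = (- ln (g z))%:E.
Proof. by rewrite /neg_log /lne; case: (leP (g z) 0%R). Qed.

Lemma weight_gt_expR n (z : n.+1.-tuple R * n.+1.-tuple R) (s : R) :
  \sum_(p : 'I_n.+1 * 'I_n.+1) neg_log g (tnth z.1 p.1, tnth z.2 p.2) < s%:E ->
  (expR (- s) < weight g z)%R.
Proof.
set X := fun p : 'I_n.+1 * 'I_n.+1 => neg_log g (tnth z.1 p.1, tnth z.2 p.2).
move=> Xs.
have Xfin p : X p < +oo.
  rewrite ltey; apply: contraTN Xs => /eqP Xp; rewrite -leNgt.
  rewrite (bigD1 p)//= -/(X p) Xp addye ?leey//.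
  rewrite -ltNye; apply: (@lt_le_trans _ _ (\sum_(q | q != p) (- C)%:E)).
    by rewrite sumEFin ltNyr.
  by apply: lee_sum => q _; exact: neg_log_ge.
have gX p := neg_log_fin (Xfin p).
have -> : weight g z = expR (- \sum_p - ln (g (tnth z.1 p.1, tnth z.2 p.2))).
  rewrite -sumrN expR_sum /weight pair_big; apply: eq_bigr => p _.
  by rewrite opprK lnK// posrE; have [] := gX p.
rewrite ltr_expR ltrN2 -lte_fin -sumEFin (le_lt_trans _ Xs)//.
by apply: lee_sum => p _; have [_ ->] := gX p.
Qed.

(** Sample the coordinates from m1 and m2.  By Markov's inequality the energy of
    the sample is at most slightly above its mean with probability bounded
    below, while the averages of the f i are close to their means with
    probability close to 1; passing from the sampling law to Lebesgue measure
    only costs a factor exp(O(n)). *)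
Lemma weight_integral_ge (m1 m2 : probability R R) (b : R) (k : nat)
    (f : nat -> R * R -> R) (a : nat -> R) (e r : R) : (0 <= b)%R ->
  (forall A, measurable A -> m1 A <= b%:E * lebesgueR A) ->
  (forall A, measurable A -> m2 A <= b%:E * lebesgueR A) ->
  (forall i, measurable_fun setT (f i)) ->
  (forall i, exists M : R, forall z, `|f i z| <= M)%R ->
  (forall i, \int[m1 \x m2]_z (f i z)%:E = (a i)%:E) -> (0 < e)%R ->
  (m1 \x m2).-integrable setT (neg_log g) ->
  \int[m1 \x m2]_z neg_log g z < (- r)%:E ->
  \forall n \near \oo, forall c : R, (0 <= c)%R ->
    (c * expR (n.+1%:R ^+ 2 * r))%:E <=
    \int[lebesgue_tuple n.+1 \x lebesgue_tuple n.+1]_(z in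
      [set z | forall i, (i < k)%N -> (`|average (f i) z - a i| < e)%R])
      (c * weight g z)%:E.
Proof.
move=> b0 m1b m2b mf fM fa e0 kint kr.
pose K z := neg_log g z + C%:E.
have mK : measurable_fun setT K by exact: measurable_neg_log_shift.
have K0 z : 0 <= K z by exact: neg_log_shift_ge0.
have kfin : \int[m1 \x m2]_z neg_log g z \is a fin_num by exact: integrable_fin_num.
pose t := (fine (\int[m1 \x m2]_z neg_log g z) + C)%R.
have Kt : \int[m1 \x m2]_z K z = t%:E.
  rewrite /K integralD//=; last exact: (@bounded_integrable _ _ R (m1 \x m2) (cst C) `|C|%R).
  by rewrite (integral_cst_prob (m1 \x m2)) /t EFinD fineK.
have t0 : (0 <= t)%R by rewrite -lee_fin -Kt integral_ge0.
have tr : (t < C - r)%R by rewrite /t addrC ltrD2l -lte_fin fineK.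
(* The energies are shifted by C to be nonnegative: t is the mean shifted energy,
   s < C - r the threshold of Markov's inequality, p the probability left. *)
pose s := ((C - r + t) / 2)%R.
have ts : (t < s)%R by rewrite /s; lra.
have s0 : (0 < s)%R by exact: le_lt_trans ts.
have sN0 : s != 0%R by rewrite gt_eqF.
pose d := (C - s - r)%R; have d0 : (0 < d)%R by rewrite /d /s; lra.
pose p := (1 - t / s)%R; have p0 : (0 < p)%R by rewrite subr_gt0 ltr_pdivrMr// mul1r.
(* A positive bound of the densities. *)
pose B := (b + 1)%R; have B0 : (0 < B)%R by rewrite /B ltr_wpDl.
have p20 : (0 < p / 2)%R by rewrite divr_gt0.
have near1 := average_near_mean k mf fM fa e0 p20.
have near2 := nbhs_infty_ger ((2 * B + 2 / p) / d)%R.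
apply: filterS2 near1 near2 => n good Nd c c0.
set G := [set z | _]; set N : R := n.+1%:R.
have N1 : (1 <= N)%R by rewrite ler1n.
pose X (z : n.+1.-tuple R * n.+1.-tuple R) :=
  \sum_(p : 'I_n.+1 * 'I_n.+1) K (tnth z.1 p.1, tnth z.2 p.2).
have mX : measurable_fun setT X.
  by apply: emeasurable_sum => q; apply: (measurableT_comp mK); exact: measurable_pair_tnth.
have X0 z : 0 <= X z by exact: sume_ge0.
have Q1 : (tuple_law m1 n.+1 \x tuple_law m2 n.+1) setT = 1.
  exact: (@probability_setT _ _ _ (tuple_law m1 n.+1 \x tuple_law m2 n.+1)).
pose QQ : probability (n.+1.-tuple R * n.+1.-tuple R)%type R :=
  tuple_law m1 n.+1 \x tuple_law m2 n.+1.
have XE : \int[QQ]_z X z = (N ^+ 2 * t)%:E.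
  rewrite /X ge0_integral_sum//; last first.
    by move=> q; apply: (measurableT_comp mK); exact: measurable_pair_tnth.
  under eq_bigr => q _ do rewrite (@integral_pair_tnth _ m1 m2 n.+1 q.1 q.2 K mK K0) Kt.
  rewrite sumEFin sumr_const card_prod card_ord -[in LHS]mulr_natl natrM -/N.
  by rewrite -expr2.
have N20 : (0 < N ^+ 2)%R by rewrite exprn_gt0// (lt_le_trans ltr01).
pose H := [set z | (N ^+ 2 * s)%:E <= X z].
have mH : measurable H.
  by rewrite -[X in measurable X]setTI; exact: emeasurable_fun_c_infty.
have QH : QQ H <= (t / s)%:E.
  have := @le_integral_abse _ _ _ QQ setT measurableT X (N ^+ 2 * s)%R mX (mulr_gt0 N20 s0).
  under eq_integral do rewrite gee0_abs//.
  rewrite XE setTI (_ : [set _ | _] = H); last first.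
    by apply/seteqP; split => z /=; rewrite gee0_abs.
  rewrite (EFinM (N ^+ 2) t) (EFinM (N ^+ 2) s) -muleA lee_pmul2l ?lte_fin// => h.
  rewrite -(@lee_pmul2l _ s%:E) ?lte_fin// (le_trans h)// -EFinM mulrCA divff ?mulr1//.
have mG : measurable G by exact: measurable_averages_near.
pose A := G `&` ~` H.
have mA : measurable A by apply: measurableI => //; exact: measurableC.
have QA : (p / 2)%:E <= QQ A.
  rewrite -[A]setCK probability_setC; last exact: measurableC.
  have : QQ (~` A) <= (1 - p / 2)%:E.
    rewrite /A setCI setCK (_ : (1 - p / 2 = p / 2 + t / s)%R); last by rewrite /p; field.
    rewrite EFinD; apply: le_trans (measureU2 _ _ _) _ => //; first exact: measurableC.
    exact: leeD good QH.
  have : QQ (~` A) \is a fin_num by exact: fin_num_measure (measurableC mA).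
  by case: (QQ (~` A)) => //= q _; rewrite -EFinB !lee_fin; lra.
have LA : (p / 2)%:E <= (B ^+ n.+1 * B ^+ n.+1)%:E *
    (lebesgue_tuple n.+1 \x lebesgue_tuple n.+1) A.
  apply: (le_trans QA).
  have bB : (b <= B)%R by rewrite /B lerDl.
  have mB (m : probability R R) :
      (forall A, measurable A -> m A <= b%:E * lebesgueR A) ->
      (forall A, measurable A -> m A <= B%:E * lebesgueR A).
    move=> mb D mD; apply: (le_trans (mb D mD)).
    by rewrite lee_wpmul2r// lee_fin.
  apply: product_measure_le => //.
  - by rewrite exprn_ge0// ltW.
  - by rewrite exprn_ge0// ltW.
  - by apply: tuple_law_le; [exact: ltW|exact: mB].
  - by apply: tuple_law_le; [exact: ltW|exact: mB].
apply: (@le_trans _ _ ((c * expR (- (N ^+ 2 * (s - C))))%:E *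
    (lebesgue_tuple n.+1 \x lebesgue_tuple n.+1) A)); last first.
  rewrite -integral_cst//.
  apply: ge0_subset_le_integral => // [z []//|z _|z _|z [Gz]].
  - by rewrite lee_fin mulr_ge0// expR_ge0.
  - by rewrite lee_fin mulr_ge0// weight_ge0.
  rewrite /H /= => /negP; rewrite -ltNge => Xz.
  rewrite lee_fin ler_wpM2l// ltW// weight_gt_expR//.
  rewrite mulrBr EFinB lteBrDr// (le_lt_trans _ Xz)// /X big_split/=.
  rewrite leeD2l// sumEFin sumr_const card_prod card_ord -[in leRHS]mulr_natl natrM -/N.
  by rewrite -expr2.
have BN0 : (0 < B ^+ n.+1 * B ^+ n.+1)%R by rewrite mulr_gt0// exprn_gt0.
pose w := (c * expR (- (N ^+ 2 * (s - C))) / (B ^+ n.+1 * B ^+ n.+1))%R.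
have w0 : (0 <= w)%R.
  by apply: divr_ge0; [rewrite mulr_ge0// expR_ge0|exact: ltW].
apply: (@le_trans _ _ (w%:E * (p / 2)%:E)); last first.
  rewrite (_ : (c * _)%:E = w%:E * (B ^+ n.+1 * B ^+ n.+1)%:E).
    by rewrite -muleA lee_wpmul2l// lee_fin.
  by rewrite -EFinM /w divfK// gt_eqF.
have expR_ge (x : R) : (x <= expR x)%R by rewrite (le_trans _ (expR_ge1Dx x))// lerDr.
have key : (expR (N ^+ 2 * r) * (B ^+ n.+1 * B ^+ n.+1) * (2 / p) <=
    expR (- (N ^+ 2 * (s - C))))%R.
  have BexpR : (B ^+ n.+1 <= expR (N * B))%R.
    by rewrite /N expRM_natl lerXn2r ?nnegrE ?expR_ge0// ltW.
  apply: (@le_trans _ _ (expR (N ^+ 2 * r) * (expR (N * B) * expR (N * B)) * expR (2 / p))%R).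
    apply: ler_pM => //; first by rewrite mulr_ge0 ?expR_ge0// ltW.
      by rewrite divr_ge0// ltW.
    by rewrite ler_wpM2l ?expR_ge0// ler_pM// exprn_ge0// ltW.
  rewrite -!expRD ler_expR.
  have Nd' : (2 * B + 2 / p <= N * d)%R.
    by rewrite -ler_pdivrMr// (le_trans Nd)// ler_nat.
  have : (N * (2 * B + 2 / p) <= N ^+ 2 * d)%R.
    by rewrite expr2 -mulrA ler_wpM2l// (le_trans ler01).
  have : (2 / p <= N * (2 / p))%R by rewrite ler_peMl// divr_ge0// ltW.
  by rewrite /d; move: (2 / p)%R => q; lra.
rewrite -EFinM lee_fin /w.
have BBN0 : (B ^+ n.+1 * B ^+ n.+1 != 0)%R by rewrite gt_eqF.
have pN0 : p != 0%R by rewrite gt_eqF.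
rewrite (_ : (c * expR (N ^+ 2 * r) = c * (expR (N ^+ 2 * r) * (B ^+ n.+1 * B ^+ n.+1) * (2 / p)) /
    (B ^+ n.+1 * B ^+ n.+1) * (p / 2))%R); last first.
  move: BBN0 pN0; move: (B ^+ n.+1 * B ^+ n.+1)%R (expR _) => BB E BBN0 pN0.
  by field; rewrite BBN0 pN0.
apply: ler_wpM2r; first exact: ltW.
by apply: ler_wpM2r; [rewrite invr_ge0 ltW|rewrite ler_wpM2l].
Qed.

End weight_lower_bound.

(** * The topology of weak convergence *)

Section weak_convergence.
Context {R : realType}.
Local Open Scope ring_scope.

Lemma cvg_ptws (U : Type) (F : set_system {ptws U -> R}) (f : {ptws U -> R}) :
  Filter F -> (forall t, (fun h : {ptws U -> R} => h t) @ F --> f t) -> F --> f.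
Proof.
move=> FF Ff; apply/cvg_sup => t A [_ [[C oC <-] Cf CA]].
have /(Ff t) FC : nbhs (f t) C by exact: open_nbhs_nbhs.
by apply: filterS CA _.
Qed.

Lemma ptws_eval_continuous (U : Type) (t : U) :
  continuous (fun h : {ptws U -> R} => h t).
Proof.
move=> f A; rewrite nbhsE => -[C [oC Cf] CA].
have /cvg_sup/(_ t) : nbhs f --> f by exact: cvg_id.
apply; exists ((fun h : U -> R => h t) @^-1` C); split => //.
  by exists C.
by move=> h /CA.
Qed.

(** The topology of weak convergence has as a base of neighbourhoods the sets
    cut out by finitely many integrals: they form a filter along which every
    integral converges. *)
Lemma prob_plane_nbhs (mu : prob_plane R) (G : set (prob_plane R)) : nbhs mu G ->
  exists (k : nat) (f : nat -> R * R -> R) (e : R),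
  [/\ (forall i, bounded_continuous (f i)), 0 < e &
      forall mu' : probability (R * R)%type R,
      (forall i, (i < k)%N ->
        `|(\int[mu']_z f i z) - \int[mu : probability _ _]_z f i z| < e) -> G mu'].
Proof.
pose B : set_system (prob_plane R) := [set A | exists (k : nat) (f : nat -> R * R -> R) (e : R),
  [/\ (forall i, bounded_continuous (f i)), 0 < e &
      forall mu' : probability (R * R)%type R,
      (forall i, (i < k)%N ->
        `|(\int[mu']_z f i z) - \int[mu : probability _ _]_z f i z| < e) -> A mu']].
have bc0 : bounded_continuous (cst 0 : R * R -> R).
  by split; [exact: cst_continuous|exists 0 => z; rewrite normr0].
have BF : Filter B.
  split.
  - by exists 0%N, (fun=> cst 0), 1; split.
  - move=> P Q [k [f [e [fbc e0 fP]]]] [l [h [d [hbc d0 hQ]]]].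
    exists (k + l)%N, (fun i => if (i < k)%N then f i else h (i - k)%N), (Num.min e d); split.
    + by move=> i; case: ifP.
    + by rewrite lt_min e0.
    + move=> mu' near; split.
        apply: fP => i ik; have := near i; rewrite ik ltn_addr//.
        by move=> /(_ isT); rewrite lt_min => /andP[].
      apply: hQ => i il; have := near (k + i)%N; rewrite ltn_add2l il ltnNge leq_addr/= addKn.
      by move=> /(_ isT); rewrite lt_min => /andP[].
  - move=> P Q PQ [k [f [e [fbc e0 fP]]]]; exists k, f, e; split => // mu' /fP; exact: PQ.
have Bcvg : {ptws, (integral_bc @ B : set_system ({f : R * R -> R | bounded_continuous f} -> R))
    --> integral_bc mu}.
  apply: cvg_ptws => -[f fbc]; apply/cvgrPdist_lt => e e0.
  exists 1%N, (fun=> f), e; split => // mu' /(_ 0%N isT) /=.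
  by rewrite distrC.
move=> [_ [[C oC <-] Cmu CG]].
have /Bcvg [k [f [e [fbc e0 fC]]]] : nbhs (integral_bc mu) C by exact: open_nbhs_nbhs.
by exists k, f, e; split => // mu' /fC; exact: CG.
Qed.

Lemma continuous_integral (f : R * R -> R) : bounded_continuous f ->
  continuous (fun mu : prob_plane R => \int[mu : probability _ _]_z f z).
Proof.
move=> fbc mu.
apply: (@continuous_comp _ _ _ (@integral_bc R) (fun h => h (exist _ f fbc))).
  exact: initial_continuous.
exact: ptws_eval_continuous.
Qed.

End weak_convergence.

(** * Marginals and empirical measures *)

Section marginals.
Context {R : realType}.

HB.instance Definition _ :=
  isMeasurableFun.Build _ _ (R * R)%type R (@fst R R) measurable_fst.
HB.instance Definition _ :=
  isMeasurableFun.Build _ _ (R * R)%type R (@snd R R) measurable_snd.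

Definition marginal1 (mu : probability (R * R)%type R) : probability R R :=
  distribution mu (@fst R R).

Definition marginal2 (mu : probability (R * R)%type R) : probability R R :=
  distribution mu (@snd R R).

Lemma marginal1E (mu : probability (R * R)%type R) A : marginal1 mu A = mu (A `*` setT).
Proof. by congr (mu _); apply/seteqP; split => -[x y] //= []. Qed.

Lemma marginal2E (mu : probability (R * R)%type R) A : marginal2 mu A = mu (setT `*` A).
Proof. by congr (mu _); apply/seteqP; split => -[x y] //= []. Qed.

End marginals.

Section empirical_integral.
Context {R : realType} (n : nat) (z : n.+1.-tuple R * n.+1.-tuple R).

Let N : R := n.+1%:R.

Lemma integral_joint_empirical (f : R * R -> \bar R) :
  measurable_fun setT f -> (forall x, 0 <= f x) ->
  \int[joint_empirical_measure z : probability _ _]_w f w =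
  ((N ^+ 2)^-1)%:E *
  \sum_(p : 'I_n.+1 * 'I_n.+1) f (tnth z.1 p.1, tnth z.2 p.2).
Proof.
move=> mf f0.
have c0 : (0 <= (N ^+ 2)^-1)%R by rewrite invr_ge0 sqr_ge0.
pose mu := mscale (NngNum c0) (msum (fun i => msum (fun j =>
      \d_(tnth z.1 (inord i), tnth z.2 (inord j))) n.+1) n.+1).
rewrite (eq_measure_integral mu)/=; last first.
  move=> A _ _; rewrite /mu/= /mscale/= /msum/joint_empirical; congr (_ * _).
  by apply: eq_bigr => i _; apply: eq_bigr => j _; rewrite !inord_val.
rewrite ge0_integral_mscale// ge0_integral_measure_sum//; congr (_ * _).
rewrite -(pair_bigA _ (fun i j => f (tnth z.1 i, tnth z.2 j)))/=.
apply: eq_bigr => i _; rewrite ge0_integral_measure_sum//.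
by apply: eq_bigr => j _; rewrite integral_dirac// diracT mul1e !inord_val.
Qed.

Lemma Rintegral_joint_empirical (f : R * R -> R) (M : R) :
  measurable_fun setT f -> (forall x, `|f x| <= M)%R ->
  (\int[joint_empirical_measure z : probability _ _]_w f w)%R = average f z.
Proof.
move=> mf fM; pose mu : probability (R * R)%type R := joint_empirical_measure z.
have intf : mu.-integrable setT (EFin \o f) := bounded_integrable mu mf fM.
have : \int[mu]_w ((f w)%:E + (cst M%:E) w) = (average f z)%:E + M%:E.
  rewrite integral_joint_empirical; last 2 first.
  - by apply: emeasurable_funD => //; exact/measurable_EFinP.
  - by move=> x /=; rewrite -EFinD lee_fin; have := fM x; rewrite ler_norml; lra.
  under eq_bigr do rewrite -EFinD.
  rewrite sumEFin -EFinM -EFinD /average -/N; congr EFin.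
  rewrite big_split/= mulrDr; congr (_ + _)%R.
  rewrite sumr_const card_prod card_ord -[X in (_ * X)%R]mulr_natl natrM -/N -expr2 mulrA.
  by rewrite mulVf ?mul1r ?expf_neq0 ?pnatr_eq0.
rewrite integralD//=; last exact: (@bounded_integrable _ _ R mu (cst M) `|M|%R).
rewrite integral_cst_prob.
have /fineK <- := integrable_fin_num measurableT intf.
by rewrite -!EFinD => -[] /addIr.
Qed.

Lemma joint_empirical_product A :
  measurable A -> joint_empirical_measure z A =
  (marginal1 (joint_empirical_measure z) \x marginal2 (joint_empirical_measure z)) A.
Proof.
move=> mA; apply/esym; apply: (@product_measure_unique _ _ _ _ R
  (marginal1 (joint_empirical_measure z)) (marginal2 (joint_empirical_measure z))
  (joint_empirical_measure z)) => // {mA}A B mA mB.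
suff : joint_empirical z (A `*` B) =
    joint_empirical z (A `*` setT) * joint_empirical z (setT `*` B).
  move=> h; transitivity (joint_empirical z (A `*` setT) * joint_empirical z (setT `*` B)).
    exact: h.
  congr (_ * _); apply/esym.
    exact: (marginal1E (joint_empirical_measure z)).
  exact: (marginal2E (joint_empirical_measure z)).
rewrite /joint_empirical.
have sumE (D E : set R) : \sum_(i < n.+1) \sum_(j < n.+1)
    \d_(tnth z.1 i, tnth z.2 j) (D `*` E) =
    ((\sum_(i < n.+1) \1_D (tnth z.1 i)) * \sum_(j < n.+1) \1_E (tnth z.2 j))%:E :> \bar R.
  rewrite mulr_suml -sumEFin; apply: eq_bigr => i _.
  rewrite mulr_sumr -sumEFin; apply: eq_bigr => j _.
  by rewrite diracE /indic in_setX -natrM mulnb.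
rewrite !sumE.
have sT (t : n.+1.-tuple R) : (\sum_(j < n.+1) \1_[set: R] (tnth t j))%R = N :> R.
  rewrite (eq_bigr (fun=> 1%R)) => [|i _]; last by rewrite indicT.
  by rewrite sumr_const card_ord.
rewrite !sT -!EFinM; congr EFin; rewrite -/N.
have N0 : N != 0%R by rewrite pnatr_eq0.
move: (\sum_(i < _) \1_A _)%R (\sum_(i < _) \1_B _)%R => a b.
by field.
Qed.

End empirical_integral.

Section rate_function.
Context {R : realType} (g : R * R -> R).

Lemma product_integrable_rate (mu : prob_plane R) nu : product_integrable g mu nu ->
  rate g mu = \int[mu : probability _ _]_z neg_log g z - inf_neg_log g.
Proof.
move=> munu; rewrite /rate; case: pselect => [h|]; last by case; exists nu.
have [muE _] := svalP (cid h).
congr (_ - _); apply: eq_measure_integral => A mA _; exact/esym/muE.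
Qed.

Lemma not_product_integrable_rate (mu : prob_plane R) :
  ~ (exists nu, product_integrable g mu nu) -> rate g mu = +oo.
Proof. by move=> h; rewrite /rate; case: pselect. Qed.

End rate_function.

(** * Product measures form a closed set *)

Section bounded_convergence.
Context d (T : measurableType d) (R : realType) (P : probability T R).

Lemma bounded_convergence (u : nat -> T -> R) (f : T -> R) (M : R) :
  (forall n, measurable_fun setT (u n)) -> measurable_fun setT f ->
  (forall n x, `|u n x| <= M)%R -> (forall x, (u n x)%R @[n --> \oo] --> f x) ->
  (\int[P]_x u n x)%R @[n --> \oo] --> (\int[P]_x f x)%R.
Proof.
move=> mu mf uM uf.
have [] := @dominated_convergence _ _ _ P setT measurableT (fun n x => (u n x)%:E)
  (EFin \o f) (cst M%:E).
- by move=> n; exact/measurable_EFinP.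
- exact/measurable_EFinP.
- by apply: aeW => x _; apply: cvg_EFin; [exact: nearW|exact: uf].
- exact: (@bounded_integrable _ _ R P (cst M) `|M|%R).
- by apply: aeW => x n _; rewrite /= lee_fin.
move=> fint _ h; apply: fine_cvg.
by rewrite /Rintegral fineK//; exact: integrable_fin_num.
Qed.

End bounded_convergence.

Section factorization.
Context {R : realType}.

Lemma measure_eq_rays (m1 m2 : {measure set R -> \bar R}) : m1 setT < +oo ->
  (forall a : R, m1 `]a, +oo[%classic = m2 `]a, +oo[%classic) ->
  forall A, measurable A -> m1 A = m2 A.
Proof.
move=> m1T m12 A mA.
apply: (@measure_unique _ _ _ (@RGenOInfty.G R) (fun n => `](- n%:R)%R, +oo[%classic)) => //.
- exact: RGenOInfty.measurableE.
- move=> _ _ [a ->] [b ->]; exists (Num.max a b); apply/seteqP; split => x /=;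
    rewrite !in_itv/= !andbT gt_max; [by case=> -> ->|by case/andP].
- by move=> n; exists (- n%:R)%R.
- rewrite -subTset => x _; exists (Num.truncn `|x|%R).+1 => //=.
  rewrite in_itv/= andbT ltrNl (le_lt_trans (ler_norm _))// normrN truncnS_gt//.
- by move=> _ [a ->].
- by move=> k; apply: le_lt_trans m1T; apply: le_measure; rewrite ?inE.
Qed.

(** Zero up to a, and increasing to 1 with n beyond a: a continuous approximation
    from below of the indicator of ]a, +oo[. *)
Definition soft_step (a : R) n (x : R) : R :=
  (1 - expR (- (`|x - a| + (x - a))) ^+ n)%R.

Lemma continuous_soft_step a n : continuous (soft_step a n).
Proof.
move=> x; apply: cvgB; first exact: cvg_cst.
apply: (@continuous_comp _ _ _ (fun x => expR (- (`|x - a| + (x - a)))%R)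
  (fun y : R => y ^+ n)%R); last exact: exprn_continuous.
apply: continuous_comp; last exact: continuous_expR.
apply: cvgN; apply: cvgD.
  apply: cvg_norm; apply: cvgB; [exact: cvg_id|exact: cvg_cst].
by apply: cvgB; [exact: cvg_id|exact: cvg_cst].
Qed.

Lemma soft_step_ge0_le1 a n x : (0 <= soft_step a n x <= 1)%R.
Proof.
have h : (0 <= `|x - a| + (x - a))%R by have := ler_norm (- (x - a)); rewrite normrN; lra.
have e1 : (expR (- (`|x - a| + (x - a))) <= 1)%R by rewrite -expR0 ler_expR oppr_le0.
by rewrite subr_ge0 exprn_ile1 ?expR_ge0//= gerBl exprn_ge0// expR_ge0.
Qed.

Lemma cvg_soft_step a x : soft_step a n x @[n --> \oo] --> (\1_(`]a, +oo[%classic) x : R).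
Proof.
rewrite indicE; case: (ltP a x) => ax.
  rewrite mem_set/=; last by rewrite in_itv/= ax.
  rewrite -[X in _ --> X]subr0; apply: cvgB; first exact: cvg_cst.
  apply: cvg_expr; rewrite ger0_norm ?expR_ge0// -expR0 ltr_expR oppr_lt0.
  by rewrite ltr_wpDl// subr_gt0.
rewrite memNset/=; last by rewrite in_itv/= ltNge ax.
rewrite (_ : (fun _ => _) = cst 0%R); first exact: cvg_cst.
apply/funext => n; rewrite /soft_step ler0_norm ?subr_le0//.
by rewrite addNr oppr0 expR0 expr1n subrr.
Qed.

Lemma soft_step_bounded_continuous1 a n :
  bounded_continuous (fun z : R * R => soft_step a n z.1).
Proof.
split; last first.
  by exists 1%R => z; have /andP[? ?] := soft_step_ge0_le1 a n z.1; rewrite ger0_norm.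
by move=> z; apply: continuous_comp; [exact: cvg_fst|exact: continuous_soft_step].
Qed.

Lemma soft_step_bounded_continuous2 a n :
  bounded_continuous (fun z : R * R => soft_step a n z.2).
Proof.
split; last first.
  by exists 1%R => z; have /andP[? ?] := soft_step_ge0_le1 a n z.2; rewrite ger0_norm.
by move=> z; apply: continuous_comp; [exact: cvg_snd|exact: continuous_soft_step].
Qed.

Lemma bounded_continuousM (f h : R * R -> R) :
  bounded_continuous f -> bounded_continuous h ->
  bounded_continuous (fun z => f z * h z)%R.
Proof.
move=> [cf [M fM]] [ch [L hL]]; split; first by move=> z; apply: cvgM; [exact: cf|exact: ch].
exists (M * L)%R => z; rewrite normrM ler_pM//.
Qed.

(** Factorization on products of test functions is a closed condition for weak
    convergence; it passes to rectangles of rays by dominated convergence, and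
    to all measurable rectangles since rays generate the Borel sets. *)
Lemma bounded_continuous_factorization (mu : probability (R * R)%type R) :
  (forall a b n, (\int[mu]_z (soft_step a n z.1 * soft_step b n z.2) =
     (\int[mu]_z soft_step a n z.1) * (\int[mu]_z soft_step b n z.2))%R) ->
  forall A, measurable A -> mu A = (marginal1 mu \x marginal2 mu) A.
Proof.
move=> mufact.
have mstep1 a n := continuous_measurable2 (soft_step_bounded_continuous1 a n).1.
have mstep2 a n := continuous_measurable2 (soft_step_bounded_continuous2 a n).1.
have m1 (D : set R) : measurable D -> measurable (D `*` [set: R]).
  by move=> mD; exact: measurableX.
have m2 (D : set R) : measurable D -> measurable ([set: R] `*` D).
  by move=> mD; exact: measurableX.
have Eindic (D : set (R * R)) : measurable D -> (\int[mu]_z \1_D z)%R = fine (mu D).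
  by move=> mD; rewrite /Rintegral integral_indic// setIT.
have le1 a n x : (`|soft_step a n x| <= 1)%R.
  by have /andP[? ?] := soft_step_ge0_le1 a n x; rewrite ger0_norm.
have muE (D : set (R * R)) : measurable D -> mu D = (fine (mu D))%:E.
  by move=> mD; rewrite fineK//; exact: fin_num_measure.
have rays a b : mu (`]a, +oo[%classic `*` `]b, +oo[%classic) =
    mu (`]a, +oo[%classic `*` setT) * mu (setT `*` `]b, +oo[%classic).
  have mab : measurable (`]a, +oo[%classic `*` `]b, +oo[%classic : set (R * R)).
    exact: measurableX.
  rewrite (muE _ mab) (muE _ (m1 _ _))// (muE _ (m2 _ _))// -EFinM; congr EFin.
  rewrite -!Eindic//; [|exact: m2|exact: m1].
  have lhs : (\int[mu]_z (soft_step a n z.1 * soft_step b n z.2))%R @[n --> \oo] -->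
      (\int[mu]_z \1_(`]a, +oo[%classic `*` `]b, +oo[%classic) z)%R.
    apply: (@bounded_convergence _ _ _ _ _ _ 1%R) => [n||n z|z].
    - exact: measurable_funM.
    - exact: measurable_indic.
    - by rewrite normrM mulr_ile1.
    - rewrite (_ : \1_(_ `*` _) z = \1_(`]a, +oo[%classic) z.1 * \1_(`]b, +oo[%classic) z.2)%R.
        by apply: cvgM; exact: cvg_soft_step.
      by case: z => x y; rewrite !indicE in_setX -natrM mulnb.
  have rhs1 : (\int[mu]_z soft_step a n z.1)%R @[n --> \oo] -->
      (\int[mu]_z \1_(`]a, +oo[%classic `*` [set: R]) z)%R.
    apply: (@bounded_convergence _ _ _ _ _ _ 1%R) => [n||n z|z] => //.
    - by apply: measurable_indic; exact: m1.
    - rewrite (_ : \1_(_ `*` _) z = \1_(`]a, +oo[%classic) z.1); first exact: cvg_soft_step.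
      by case: z => x y; rewrite !indicE in_setX in_setT andbT.
  have rhs2 : (\int[mu]_z soft_step b n z.2)%R @[n --> \oo] -->
      (\int[mu]_z \1_([set: R] `*` `]b, +oo[%classic) z)%R.
    apply: (@bounded_convergence _ _ _ _ _ _ 1%R) => [n||n z|z] => //.
    - by apply: measurable_indic; exact: m2.
    - rewrite (_ : \1_(_ `*` _) z = \1_(`]b, +oo[%classic) z.2); first exact: cvg_soft_step.
      by case: z => x y; rewrite !indicE in_setX in_setT.
  apply: (cvg_unique (@Rhausdorff R) lhs).
  rewrite (_ : (fun n => _) = fun n =>
    ((\int[mu]_z soft_step a n z.1) * (\int[mu]_z soft_step b n z.2))%R).
    exact: cvgM rhs1 rhs2.
  by apply/funext => n; exact: mufact.
have fine0 (D : set (R * R)) : (0 <= fine (mu D))%R by exact: fine_ge0.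
have eq1 b A : measurable A -> mu (A `*` `]b, +oo[%classic) =
    mu (A `*` setT) * mu (setT `*` `]b, +oo[%classic).
  move=> mA; pose D : set (R * R) := setT `*` `]b, +oo[%classic.
  have mD : measurable D by exact: m2.
  pose l : {measure set R -> \bar R} :=
    measure_function_pushforward__canonical__measure_function_Measure (mrestr mu mD)
      (@measurable_fst _ _ R R).
  pose r : {measure set R -> \bar R} := mscale (NngNum (fine0 D)) (marginal1 mu).
  have lE E : l E = mu (E `*` `]b, +oo[%classic).
    rewrite /l/= /pushforward /mrestr/=; congr (mu _).
    by apply/seteqP; split => -[x y] /=; [case=> ? []|case].
  have rE E : r E = mu (E `*` setT) * mu D.
    rewrite /r/= /mscale/= [RHS]muleC (muE D)//; congr (_ * _).
    exact: (marginal1E mu).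
  rewrite -lE -rE; apply: measure_eq_rays => // [|a].
    rewrite lE; apply: (@le_lt_trans _ _ 1); last by rewrite ltry.
    by apply: probability_le1.
  by rewrite lE rE rays.
move=> X mX; apply/esym; apply: (@product_measure_unique _ _ _ _ R
  (marginal1 mu) (marginal2 mu) mu) => // {mX X}A B mA mB.
pose D : set (R * R) := A `*` setT.
have mD : measurable D by exact: m1.
pose l : {measure set R -> \bar R} :=
  measure_function_pushforward__canonical__measure_function_Measure (mrestr mu mD)
    (@measurable_snd _ _ R R).
pose r : {measure set R -> \bar R} := mscale (NngNum (fine0 D)) (marginal2 mu).
have lE E : l E = mu (A `*` E).
  rewrite /l/= /pushforward /mrestr/=; congr (mu _).
  by apply/seteqP; split => -[x y] /=; [case=> ? []|case].
have rE E : r E = mu D * mu (setT `*` E).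
  rewrite /r/= /mscale/= (muE D)//; congr (_ * _).
  exact: (marginal2E mu).
transitivity (mu D * mu (setT `*` B)); last first.
  by congr (_ * _); apply/esym; [exact: (marginal1E mu)|exact: (marginal2E mu)].
transitivity (l B); first exact/esym/lE.
transitivity (r B); last exact: rE.
apply: measure_eq_rays => // [|a].
  rewrite lE; apply: (@le_lt_trans _ _ 1); last by rewrite ltry.
  by apply: probability_le1.
by rewrite lE rE eq1.
Qed.

End factorization.

(** * Lower semicontinuity of the rate function *)

Section energy.
Context {R : realType} (g : R * R -> R).
Hypothesis g_cont : continuous g.
Hypothesis g_ge0 : forall z, (0 <= g z)%R.
Variable C : R.
Hypothesis g_le : forall z, (g z + 1 <= expR C)%R.

Let g_meas : measurable_fun setT g := continuous_measurable2 g_cont.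

Let g_le' z : (g z <= expR C)%R.
Proof. by rewrite (le_trans _ (g_le z))// lerDl. Qed.

Let nl_ge := neg_log_ge g_le'.
Let nl_meas := measurable_neg_log g_meas.

Let shift0 z : 0 <= neg_log g z + C%:E.
Proof. exact: neg_log_shift_ge0. Qed.

Let shift_meas : measurable_fun setT (fun z => neg_log g z + C%:E).
Proof. exact: emeasurable_funD. Qed.

Lemma integrable_neg_log (mu : probability (R * R)%type R) :
  \int[mu]_z (neg_log g z + C%:E) < +oo -> mu.-integrable setT (neg_log g).
Proof.
move=> fin; have Kint : mu.-integrable setT (fun z => neg_log g z + C%:E).
  by apply/integrableP; split => //; under eq_integral do rewrite gee0_abs//.
have := integrableB measurableT Kint (@bounded_integrable _ _ R mu (cst C) `|C|%R _ _).
move=> /(_ _ _)/eq_integrable; apply => //.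
by move=> z _; rewrite /= addeK.
Qed.

Lemma integral_neg_log_shift (mu : probability (R * R)%type R) :
  mu.-integrable setT (neg_log g) ->
  \int[mu]_z (neg_log g z + C%:E) = \int[mu]_z neg_log g z + C%:E.
Proof.
move=> kint; rewrite integralD//=; last exact: (@bounded_integrable _ _ R mu (cst C) `|C|%R).
by rewrite integral_cst_prob.
Qed.

(** Increasing to neg_log g with n, and bounded since the argument of the
    logarithm is bounded away from 0 and from infinity. *)
Definition neg_log_trunc n (z : R * R) : R := (- ln (g z + n.+1%:R^-1))%R.

Let arg_gt0 n z : (0 < g z + n.+1%:R^-1)%R.
Proof. by rewrite ltr_wpDl// invr_gt0. Qed.

Lemma neg_log_trunc_bounded_continuous n : bounded_continuous (neg_log_trunc n).
Proof.
split.
  move=> z; apply: cvgN.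
  apply: (@continuous_comp _ _ _ (fun z => g z + n.+1%:R^-1)%R (@ln R)).
    by apply: cvgD; [exact: g_cont|exact: cvg_cst].
  exact: continuous_ln.
exists (`|C| + `|ln n.+1%:R|)%R => z; rewrite /neg_log_trunc normrN.
have lo : (- `|ln n.+1%:R| <= ln (g z + n.+1%:R^-1) :> R)%R.
  apply: (@le_trans _ _ (ln (n.+1%:R^-1))); last by rewrite ler_ln ?posrE// lerDr.
  by rewrite lnV ?posrE// lerN2 ler_norm.
have hi : (ln (g z + n.+1%:R^-1) <= `|C|)%R.
  rewrite (le_trans _ (ler_norm C))// -ler_expR lnK ?posrE//.
  by rewrite (le_trans _ (g_le z))// lerD2l invf_le1// ler1n.
by rewrite ler_norml; apply/andP; split; [rewrite opprD ler_wnDl// oppr_le0|rewrite ler_wpDr].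
Qed.

Lemma neg_log_trunc_ge n z : (0 <= neg_log_trunc n z + C)%R.
Proof.
rewrite /neg_log_trunc addrC subr_ge0 -ler_expR lnK ?posrE//.
by rewrite (le_trans _ (g_le z))// lerD2l invf_le1// ler1n.
Qed.

Lemma neg_log_trunc_le n z : (neg_log_trunc n z)%:E <= neg_log g z.
Proof.
rewrite /neg_log /lne /neg_log_trunc; case: (leP (g z) 0%R) => [_|gz]; first by rewrite leey.
by rewrite EFinN leeN2 lee_fin ler_ln ?posrE// lerDl.
Qed.

Lemma neg_log_trunc_nd z : nondecreasing_seq (fun n => neg_log_trunc n z).
Proof.
move=> m n mn; rewrite lerN2 ler_ln ?posrE// lerD2l lef_pV2 ?posrE//.
by rewrite ler_nat.
Qed.

Lemma cvg_neg_log_trunc z : (neg_log_trunc n z)%:E @[n --> \oo] --> neg_log g z.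
Proof.
rewrite /neg_log /lne /neg_log_trunc; case: (leP (g z) 0%R) => [gz|gz].
  have -> : g z = 0%R by apply/eqP; rewrite eq_le gz g_ge0.
  apply/cvgeyPge => A; have := nbhs_infty_ger (expR A); apply: filterS => n An.
  rewrite lee_fin add0r lnV ?posrE// opprK -ler_expR lnK ?posrE//.
  by rewrite (le_trans An)// ler_nat.
rewrite -EFinN; apply: cvg_EFin; first exact: nearW.
apply: cvgN; apply: continuous_cvg; first exact: continuous_ln.
rewrite -[X in _ --> X]addr0; apply: cvgD; first exact: cvg_cst.
exact: cvg_harmonic.
Qed.

Lemma cvg_integral_neg_log_trunc (mu : probability (R * R)%type R) :
  \int[mu]_z (neg_log_trunc n z + C)%:E @[n --> \oo] -->
  \int[mu]_z (neg_log g z + C%:E).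
Proof.
have lim z : (neg_log_trunc n z + C)%:E @[n --> \oo] --> neg_log g z + C%:E.
  under eq_fun do rewrite EFinD.
  by apply: cvgeD; [exact: fin_num_adde_defl|exact: cvg_neg_log_trunc|exact: cvg_cst].
rewrite (eq_integral (fun z => limn (fun n => (neg_log_trunc n z + C)%:E))); last first.
  by move=> z _; apply/esym/cvg_lim => //; exact: lim.
apply: (@cvg_monotone_convergence _ _ _ _ _ measurableT
  (fun n z => (neg_log_trunc n z + C)%:E)).
- move=> n; apply/measurable_EFinP; apply: measurable_funD => //.
  exact: continuous_measurable2 (neg_log_trunc_bounded_continuous n).1.
- by move=> n z _; rewrite lee_fin neg_log_trunc_ge.
- by move=> z _ m n mn; rewrite lee_fin lerD2r; exact: neg_log_trunc_nd.
Qed.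

Lemma exists_neg_log_trunc_gt (mu : probability (R * R)%type R) (b : \bar R) :
  b < \int[mu]_z (neg_log g z + C%:E) ->
  exists n, b < \int[mu]_z (neg_log_trunc n z + C)%:E.
Proof.
move=> bmu.
apply: contrapT => /forallNP h; move: bmu; apply/negP; rewrite -leNgt.
have cvgmu := @cvg_integral_neg_log_trunc mu.
rewrite -(cvg_lim (@ereal_hausdorff R) cvgmu); apply: lime_le.
  by apply/cvg_ex; eexists; exact: cvgmu.
by apply: nearW => n; rewrite leNgt; apply/negP; exact: h.
Qed.

(** The failure of this identity is an open condition on mu, so that measures near
    one that is not a product have infinite rate. *)
Lemma product_integrable_factorization (mu : prob_plane R) nu (f h : R -> R) :
  product_integrable g mu nu ->
  measurable_fun setT f -> (forall x, 0 <= f x <= 1)%R ->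
  measurable_fun setT h -> (forall x, 0 <= h x <= 1)%R ->
  (\int[mu : probability _ _]_z (f z.1 * h z.2) =
   (\int[mu : probability _ _]_z f z.1) * (\int[mu : probability _ _]_z h z.2))%R.
Proof.
move=> [muE _] mf f1 mh h1.
have f0 x : (0 <= f x)%R by have /andP[] := f1 x.
have h0 x : (0 <= h x)%R by have /andP[] := h1 x.
have munu (F : R * R -> \bar R) :
    \int[mu : probability _ _]_z F z = \int[nu.1 \x nu.2]_z F z.
  by apply: eq_measure_integral => A mA _; exact: muE.
rewrite /Rintegral !munu.
have mf1 : measurable_fun setT (fun z : R * R => f z.1) by exact: measurableT_comp.
have mh2 : measurable_fun setT (fun z : R * R => h z.2) by exact: measurableT_comp.
have -> : \int[nu.1 \x nu.2]_z (f z.1)%:E = \int[nu.1]_x (f x)%:E.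
  rewrite fubini_tonelli1//=; [|exact/measurable_EFinP|by move=> z; rewrite lee_fin].
  by apply: eq_integral => x _; exact: (integral_cst_prob nu.2 (f x)).
have -> : \int[nu.1 \x nu.2]_z (h z.2)%:E = \int[nu.2]_y (h y)%:E.
  rewrite fubini_tonelli2//=; [|exact/measurable_EFinP|by move=> z; rewrite lee_fin].
  by apply: eq_integral => x _; exact: (integral_cst_prob nu.1 (h x)).
rewrite fubini_tonelli1//=; last 2 first.
- by apply/measurable_EFinP; exact: measurable_funM.
- by move=> z; rewrite lee_fin mulr_ge0.
rewrite /fubini_F/=; under eq_integral => x _.
  under eq_integral do rewrite EFinM.
  rewrite ge0_integralZl//=; last 3 first.
  - exact/measurable_EFinP.
  - by move=> y _; rewrite lee_fin.
  - by rewrite lee_fin.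
  over.
rewrite ge0_integralZr//=; last 3 first.
- exact/measurable_EFinP.
- by move=> y _; rewrite lee_fin.
- by apply: integral_ge0 => y _; rewrite lee_fin.
have bnd (P : probability R R) (u : R -> R) : measurable_fun setT u ->
    (forall x, 0 <= u x <= 1)%R -> \int[P]_x (u x)%:E \is a fin_num.
  move=> meas u1; apply: integrable_fin_num => //.
  apply: (@bounded_integrable _ _ R P u 1%R) => // x.
  by have /andP[? ?] := u1 x; rewrite ger0_norm.
by rewrite fineM// bnd.
Qed.

Hypothesis I0_fin : inf_neg_log g \is a fin_num.

Lemma rate_ge0 (mu : prob_plane R) : 0 <= rate g mu.
Proof.
have [[nu munu]|npi] := pselect (exists nu, product_integrable g mu nu); last first.
  by rewrite not_product_integrable_rate.
rewrite (product_integrable_rate munu) sube_ge0; last by rewrite I0_fin.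
pose P : probability (R * R)%type R := mu.
have I0E : inf_neg_log g = (fine (inf_neg_log g))%:E by rewrite fineK.
rewrite I0E -(integral_cst_prob P); apply: le_integral => //.
- exact: (@bounded_integrable _ _ R P (cst (fine (inf_neg_log g))) `|fine (inf_neg_log g)|%R).
- exact: munu.2.
- by move=> z _; rewrite /= -I0E; apply: ereal_inf_lbound; exists z.
Qed.

(** On product measures the rate is the shifted energy up to constants, the value
    +oo corresponding to an infinite energy. *)
Lemma lt_integral_of_rate (mu : prob_plane R) (a : R) :
  (forall A, measurable A ->
    (mu : probability _ _) A = (marginal1 mu \x marginal2 mu) A) ->
  a%:E < rate g mu ->
  a%:E + inf_neg_log g + C%:E < \int[mu : probability _ _]_z (neg_log g z + C%:E).
Proof.
move=> muE amu.
have [fin|] := ltP (\int[mu : probability _ _]_z (neg_log g z + C%:E)) +oo; last first.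
  rewrite leye_eq => /eqP ->.
  by case: (inf_neg_log g) I0_fin => // r _; rewrite -!EFinD ltry.
have kint := integrable_neg_log fin.
rewrite integral_neg_log_shift// lteD2rE// -lteBrDr//.
by rewrite -(@product_integrable_rate _ g mu (marginal1 mu, marginal2 mu)).
Qed.

(** Near a measure that is not a product, a pair of soft steps keeps failing to
    factorize, so the rate is +oo.  Near a product measure the rate is bounded
    below by the integral of one of the functions neg_log_trunc n, which is
    continuous in the measure. *)
Lemma rate_lower_semicontinuous : lower_semicontinuous (rate g).
Proof.
move=> mu a amu.
have [muE|] := pselect (forall A, measurable A ->
    (mu : probability _ _) A = (marginal1 mu \x marginal2 mu) A); last first.
  move=> nprod.
  have [x [y [n]]] : exists x y n,
      (\int[mu : probability _ _]_z (soft_step x n z.1 * soft_step y n z.2) -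
       (\int[mu : probability _ _]_z soft_step x n z.1) *
       (\int[mu : probability _ _]_z soft_step y n z.2) != 0)%R.
    apply: contrapT => h; apply: nprod => A mA.
    apply: bounded_continuous_factorization => // x y n.
    apply/eqP; rewrite -subr_eq0; apply: contrapT => /negP h'; apply: h.
    by exists x, y, n.
  set D := fun mu : prob_plane R =>
      (\int[mu : probability _ _]_z (soft_step x n z.1 * soft_step y n z.2) -
       (\int[mu : probability _ _]_z soft_step x n z.1) *
       (\int[mu : probability _ _]_z soft_step y n z.2))%R.
  move=> Dmu.
  have Dcont : continuous D.
    have c1 := continuous_integral (soft_step_bounded_continuous1 x n).
    have c2 := continuous_integral (soft_step_bounded_continuous2 y n).
    have c12 := continuous_integral (bounded_continuousM
      (soft_step_bounded_continuous1 x n) (soft_step_bounded_continuous2 y n)).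
    by move=> nu; exact: (cvgB (c12 nu) (cvgM (c1 nu) (c2 nu))).
  exists (D @^-1` [set t | t != 0%R]).
    apply: Dcont; apply: open_nbhs_nbhs; split => //.
  move=> nu /= Dnu; rewrite not_product_integrable_rate ?ltry//.
  move=> [ab nuab]; move/eqP: Dnu; apply.
  rewrite /D (product_integrable_factorization nuab) ?subrr//.
  - exact: (continuous_measurable_fun (@continuous_soft_step _ x n)).
  - exact: soft_step_ge0_le1.
  - exact: (continuous_measurable_fun (@continuous_soft_step _ y n)).
  - exact: soft_step_ge0_le1.
have := lt_integral_of_rate muE amu.
set b := _ + C%:E => bmu.
have [n bn] : exists n, b < \int[mu : probability _ _]_z (neg_log_trunc n z + C)%:E.
  exact: exists_neg_log_trunc_gt bmu.
have truncE (nu : prob_plane R) : \int[nu : probability _ _]_z (neg_log_trunc n z + C)%:E =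
    ((\int[nu : probability _ _]_z neg_log_trunc n z)%R + C)%:E.
  pose P : probability (R * R)%type R := nu.
  have [tcont [M tM]] := neg_log_trunc_bounded_continuous n.
  have tint := bounded_integrable P (continuous_measurable2 tcont) tM.
  have := integralD measurableT tint (@bounded_integrable _ _ R P (cst C) `|C|%R _ _).
  move=> /(_ _ _)/= -> //; rewrite integral_cst_prob EFinD /Rintegral fineK//.
  exact: integrable_fin_num tint.
pose V := [set nu : prob_plane R | b < ((\int[nu : probability _ _]_z neg_log_trunc n z)%R + C)%:E].
exists V.
  have Tcont := continuous_integral (neg_log_trunc_bounded_continuous n).
  have bfin : b = (fine b)%:E.
    by rewrite fineK// /b; case: (inf_neg_log g) I0_fin.
  rewrite /V bfin; under eq_set do rewrite lte_fin -ltrBlDr.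
  apply: (Tcont mu [set t | (fine b - C < t)%R]).
  apply: open_nbhs_nbhs; split; first exact: open_gt.
  by rewrite /= ltrBlDr -lte_fin -bfin -truncE.
move=> nu Vnu.
have [[ab nuab]|npi] := pselect (exists ab, product_integrable g nu ab); last first.
  by rewrite not_product_integrable_rate// ltry.
rewrite (product_integrable_rate nuab) lteBrDr//.
rewrite -(@lteD2rE _ C%:E)// (lt_le_trans Vnu)// -truncE.
rewrite -integral_neg_log_shift; last exact: nuab.2.
apply: ge0_subset_le_integral => // z _; rewrite ?lee_fin ?neg_log_trunc_ge//.
by rewrite EFinD leeD2r// neg_log_trunc_le.
Qed.

End energy.

(** * Conditioning and smoothing *)

Lemma ge0_integral_mrestr d (T : measurableType d) (R : realType)
    (m : {measure set T -> \bar R}) (D : set T) (mD : measurable D) (f : T -> \bar R) :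
  measurable_fun setT f -> (forall x, 0 <= f x) ->
  \int[mrestr m mD]_x f x = \int[m]_(x in D) f x.
Proof.
move=> mf f0; rewrite -[in LHS](setvU D) ge0_integral_setU//; last 3 first.
- exact: measurableC.
- by rewrite setvU.
- by rewrite disj_set2E setICl.
rewrite (eq_measure_integral mzero) => [|A mA AD]; last first.
  by rewrite /= /mrestr (_ : A `&` D = set0) ?measure0//; exact/disjoints_subset.
rewrite integral_measure_zero add0e; apply: eq_measure_integral => A mA AD.
by rewrite /= /mrestr (setIidl AD).
Qed.

Section conditioning.
Context d (T : measurableType d) (R : realType).

(** The value dirac point is only taken when m D is 0 or infinite. *)
Definition conditional (m : {measure set T -> \bar R}) (D : set T) (mD : measurable D) :
    probability T R := mnormalize (mrestr m mD) (dirac point).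

Lemma conditionalE (m : {measure set T -> \bar R}) (D : set T) (mD : measurable D) (p : R) A :
  m D = p%:E -> (0 < p)%R -> conditional m mD A = (p^-1)%:E * m (A `&` D).
Proof.
move=> Dp p0; transitivity (mnormalize (mrestr m mD) (dirac point : probability T R) A) => //.
rewrite /mnormalize /= /mrestr setTI Dp.
by rewrite eqe gt_eqF//= muleC.
Qed.

Lemma integral_conditional (m : {measure set T -> \bar R}) (D : set T) (mD : measurable D)
    (p : R) (f : T -> \bar R) : m D = p%:E -> (0 < p)%R ->
  measurable_fun setT f -> (forall x, 0 <= f x) ->
  \int[conditional m mD]_x f x = (p^-1)%:E * \int[m]_(x in D) f x.
Proof.
move=> Dp p0 mf f0.
have p'0 : (0 <= p^-1)%R by rewrite invr_ge0 ltW.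
rewrite [LHS](eq_measure_integral (mscale (NngNum p'0) (mrestr m mD))); last first.
  by move=> A mA _; exact: (conditionalE mD A Dp p0).
by rewrite ge0_integral_mscale// ge0_integral_mrestr.
Qed.

End conditioning.

Section smoothing.
Context {R : realType}.

Lemma lebesgueR_translation (A : set R) (x : R) : measurable A ->
  lebesgueR [set u | A (x + u)%R] = lebesgueR A.
Proof.
move=> mA; have mtr : measurable_fun [set: measurableTypeR R]
    (fun u : measurableTypeR R => (x + u)%R : measurableTypeR R).
  exact: measurable_funD.
pose nu : {measure set (measurableTypeR R) -> \bar R} :=
  measure_function_pushforward__canonical__measure_function_Measure (@lebesgue_measure R) mtr.
apply/esym; apply: (lebesgue_measure_unique (mu := nu)) => //= _ [[a b]] _ <-.
rewrite /nu/= /pushforward (_ : _ @^-1` _ = `](a - x)%R, (b - x)%R]%classic); last first.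
  by apply/seteqP; split => u /=; rewrite !in_itv/= ltrBlDl lerBrDl.
rewrite /= !lebesgue_measure_itv/= !lte_fin ltrD2r -!EFinB.
by rewrite (_ : b - x - (a - x) = b - a)%R//; ring.
Qed.

Lemma measurable_Icc (a b : R) : measurable `[a, b]%classic.
Proof. exact: measurable_itv. Qed.

Definition uniform (d : R) : probability R R := conditional lebesgueR (measurable_Icc 0 d).

Lemma lebesgueR_Icc (a b : R) : (a <= b)%R -> lebesgueR `[a, b]%classic = (b - a)%:E.
Proof.
move=> ab; rewrite /lebesgueR lebesgue_measure_itv/= lte_fin; case: ltP => //= ba.
by rewrite (_ : a = b) ?subrr//; apply/eqP; rewrite eq_le ab ba.
Qed.

Lemma uniformE (d : R) A : (0 < d)%R ->
  uniform d A = (d^-1)%:E * lebesgueR (A `&` `[0%R, d]%classic).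
Proof.
move=> d0; apply: conditionalE => //.
by rewrite -[in RHS](subr0 d); apply: lebesgueR_Icc; exact: ltW.
Qed.

Definition clamp (d u : R) : R := Num.max 0%R (Num.min u d).

Lemma clamp_id d u : (0 <= u <= d)%R -> clamp d u = u.
Proof. by move=> /andP[u0 ud]; rewrite /clamp min_l// max_r. Qed.

Lemma clamp_ge0_le d u : (0 <= d)%R -> (0 <= clamp d u <= d)%R.
Proof. by move=> d0; rewrite /clamp le_max lexx/= ge_max d0 ge_min lexx orbT. Qed.

Definition jitter (d : R) (z : R * R) : R := (z.1 + clamp d z.2)%R.

Lemma measurable_clamp d : measurable_fun setT (clamp d).
Proof. by apply: measurable_maxr => //; apply: measurable_minr. Qed.

Lemma measurable_jitter d : measurable_fun setT (jitter d).
Proof.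
apply: measurable_funD; first exact: measurable_fst.
by apply: measurableT_comp; [exact: measurable_clamp|exact: measurable_snd].
Qed.

HB.instance Definition _ d := isMeasurableFun.Build _ _ _ _ (jitter d) (measurable_jitter d).

(** The convolution of m with the uniform law on [0, d].  For d > 0 the clamp in
    jitter is almost surely the identity; it keeps the displacement at most d
    everywhere and not only almost everywhere. *)
Definition smoothed (m : probability R R) (d : R) : probability R R :=
  distribution (m \x uniform d) (jitter d).

(** A convolution has density at most 1/d, because Lebesgue measure is invariant
    under translation. *)
Lemma smoothed_le (m : probability R R) (d : R) A : (0 < d)%R -> measurable A ->
  smoothed m d A <= (d^-1)%:E * lebesgueR A.
Proof.
move=> d0 mA; rewrite /smoothed /distribution/= /pushforward/= /product_measure1.
apply: (@le_trans _ _ (\int[m]_x (cst ((d^-1)%:E * lebesgueR A)) x)).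
  apply: ge0_subset_le_integral => // x _; first by rewrite mule_ge0// lee_fin invr_ge0 ltW.
  rewrite /= uniformE//; apply: lee_wpmul2l; first by rewrite lee_fin invr_ge0 ltW.
  rewrite -(lebesgueR_translation x mA).
  rewrite (_ : _ `&` _ = [set u | A (x + u)%R] `&` `[0%R, d]%classic); last first.
    apply/seteqP; split => u [/=]; rewrite /xsection/= inE /jitter/= in_itv/= => Au ud.
      by rewrite clamp_id// in Au.
    by rewrite clamp_id.
  have mAx : measurable [set u | A (x + u)%R].
    rewrite -[X in measurable X]setTI.
    by apply: (measurable_funD (f := cst x) (g := id) _ _ measurableT mA).
  by apply: le_measure; rewrite ?inE//; apply: measurableI => //; exact: measurable_Icc.
by rewrite integral_cst//= probability_setT mule1.
Qed.

End smoothing.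

Lemma ge0_integral_prodM (R : realType) (m1 m2 : probability R R) (a b : R -> \bar R) :
  measurable_fun setT a -> (forall x, 0 <= a x) ->
  measurable_fun setT b -> (forall x, 0 <= b x) ->
  \int[m1 \x m2]_z (a z.1 * b z.2) = \int[m1]_x a x * \int[m2]_y b y.
Proof.
move=> ma a0 mb b0; rewrite fubini_tonelli1//=; last 2 first.
- by apply: emeasurable_funM; exact: measurableT_comp.
- by move=> z; rewrite mule_ge0.
rewrite /fubini_F/=; under eq_integral => x _ do rewrite ge0_integralZl//=.
by rewrite ge0_integralZr//; exact: integral_ge0.
Qed.

Section smoothed_integral.
Context {R : realType} (m1 m2 : probability R R) (d : R).

Definition jitter2 (z w : R * R) : R * R := (z.1 + clamp d w.1, z.2 + clamp d w.2)%R.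

Lemma measurable_jitter2 :
  measurable_fun setT (fun p : (R * R) * (R * R) => jitter2 p.1 p.2).
Proof.
apply/measurable_fun_pairP; split; apply: measurable_funD.
- exact: (measurableT_comp measurable_fst measurable_fst).
- apply: (measurableT_comp (@measurable_clamp R d)).
  exact: (measurableT_comp measurable_fst measurable_snd).
- exact: (measurableT_comp measurable_snd measurable_fst).
- apply: (measurableT_comp (@measurable_clamp R d)).
  exact: (measurableT_comp measurable_snd measurable_snd).
Qed.

(** Writing the smoothed integral as an integral against the original measure of
    local means of phi prepares the use of dominated convergence. *)
Lemma integral_smoothed (phi : R * R -> \bar R) :
  measurable_fun setT phi -> (forall z, 0 <= phi z) ->
  \int[smoothed m1 d \x smoothed m2 d]_z phi z =
  \int[m1 \x m2]_z \int[uniform d \x uniform d]_w phi (jitter2 z w).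
Proof.
move=> mphi phi0.
pose P : probability (R * R)%type R := m1 \x m2.
pose U : probability (R * R)%type R := uniform d \x uniform d.
pose mu : {measure set ((R * R) * (R * R))%type -> \bar R} := P \x U.
pose pi : {measure set (R * R)%type -> \bar R} :=
  measure_function_pushforward__canonical__measure_function_Measure mu measurable_jitter2.
rewrite (eq_measure_integral pi); last first.
  move=> X mX _; apply: (@product_measure_unique _ _ _ _ R
    (smoothed m1 d) (smoothed m2 d) pi) => // {mX X}A B mA mB.
  pose a (E : set R) x : \bar R := uniform d [set u | E (jitter d (x, u))].
  have msec (E : set R) x : measurable E -> measurable [set u | E (jitter d (x, u))].
    move=> mE; rewrite (_ : [set _ | _] = xsection (jitter d @^-1` E) x).
      apply: measurable_xsection; rewrite -[X in measurable X]setTI.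
      exact: measurable_jitter.
    by apply/seteqP; split => u; rewrite /xsection/= inE.
  have aE (E : set R) x : a E x = (uniform d \o xsection (jitter d @^-1` E)) x.
    by congr (uniform d _); apply/seteqP; split => u; rewrite /xsection/= inE.
  have ma (E : set R) : measurable E -> measurable_fun setT (a E).
    move=> mE; rewrite (funext (aE E)); apply: measurable_fun_xsection.
    by rewrite -[X in measurable X]setTI; exact: measurable_jitter.
  have smE (m : probability R R) (E : set R) : smoothed m d E = \int[m]_x a E x.
    by rewrite (funext (aE E)).
  transitivity (\int[m1 \x m2]_z (a A z.1 * a B z.2)).
    rewrite /pi/= /pushforward/= {1}/product_measure1; apply: eq_integral => z _ /=.
    transitivity ((uniform d \x uniform d)
        ([set u | A (jitter d (z.1, u))] `*` [set u | B (jitter d (z.2, u))])).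
      by congr (product_measure1 _ _ _); apply/seteqP; split => w; rewrite /xsection/= inE.
    by rewrite product_measure1E//; exact: msec.
  rewrite ge0_integral_prodM//; [|exact: ma|exact: ma].
  by congr (_ * _); exact/esym/smE.
rewrite ge0_integral_pushforward//; last exact: measurable_jitter2.
rewrite preimage_setT fubini_tonelli1//.
  exact: (measurableT_comp mphi measurable_jitter2).
by move=> p; exact: phi0.
Qed.

Lemma measurable_smoothed_integrand (phi : R * R -> \bar R) :
  measurable_fun setT phi -> (forall z, 0 <= phi z) ->
  measurable_fun setT (fun z => \int[uniform d \x uniform d]_w phi (jitter2 z w)).
Proof.
move=> mphi phi0.
pose U : probability (R * R)%type R := uniform d \x uniform d.
apply: (measurable_fun_fubini_tonelli_F (m2 := U) (fun p => phi (jitter2 p.1 p.2))) => //.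
exact: (measurableT_comp mphi measurable_jitter2).
Qed.

End smoothed_integral.

(** * Local means of a logarithmic singularity *)

Section logarithmic_singularity.
Context {R : realType}.

Let q : R := expR (-1).

Let q0 : (0 < q)%R. Proof. exact: expR_gt0. Qed.

Let q1 : (q < 1)%R. Proof. by rewrite -expR0 ltr_expR ltrN10. Qed.

Definition log_singularity (t : R) : \bar R := - lne `|t|%R%:E.

(** The number of k with |s| <= e^-k: an upper bound of the positive part of
    -log|s| by a series of indicators of intervals, easy to integrate. *)
Definition log_layers (s : R) : \bar R :=
  \sum_(0 <= k <oo) ((`|s| <= q ^+ k)%R%:R : R)%:E.

Lemma log_layers_ge0 s : 0 <= log_layers s.
Proof. by apply: nneseries_ge0 => k _ _; rewrite lee_fin. Qed.

Lemma log_layers_ge N s : (`|s| <= q ^+ N)%R -> (N.+1%:R)%:E <= log_layers s.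
Proof.
move=> sN; apply: (@le_trans _ _ (\sum_(0 <= k < N.+1) ((`|s| <= q ^+ k)%R%:R : R)%:E)).
  rewrite (eq_big_nat _ _ (F2 := fun=> 1%:E)) => [|k /andP[_ kN]].
    by rewrite sumEFin lee_fin big_const_nat subn0 iter_addr_0.
  rewrite (le_trans sN)// ler_wiXn2l ?ltW//.
by apply: nneseries_lim_ge => k _; rewrite lee_fin.
Qed.

Lemma log_singularity_le_layers s : log_singularity s <= log_layers s.
Proof.
rewrite /log_singularity /lne; case: (leP `|s|%R 0%R) => [s0|s0].
  rewrite leye_eq; apply/eqP/eqyP => A A0.
  apply: le_trans (log_layers_ge (N := Num.truncn A) _).
    by rewrite lee_fin ltW// truncnS_gt.
  by rewrite (le_trans s0)// exprn_ge0// ltW.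
have [s1|s1] := leP 1%R `|s|%R.
  apply: le_trans (log_layers_ge0 s).
  by rewrite leeNl oppe0 lee_fin ln_ge0.
have ln0 : (0 <= - ln `|s|)%R by rewrite oppr_ge0 ln_le0// ltW.
apply: le_trans (log_layers_ge (N := Num.truncn (- ln `|s|)%R) _).
  by rewrite -EFinN lee_fin ltW// truncnS_gt.
rewrite /q -expRM_natr mulN1r -[leLHS]lnK ?posrE// ler_expR lerNr.
by rewrite truncn_le.
Qed.

(** Uniformly in d, a shift by at most d increases the singularity by at most
    log 2 plus the layers at the rescaled point: |t + v| is at least |t| / 2
    when |t| is at least 2 d, and at least (|t| / 2) |t + v| / d otherwise. *)
Lemma log_singularity_shift (t v d : R) : (0 < d)%R -> (`|v| <= d)%R ->
  log_singularity (t + v) <= log_singularity t + (ln 2)%:E + log_layers ((t + v) / d).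
Proof.
move=> d0 vd.
have ln20 : (0 <= ln 2 :> R)%R by rewrite ln_ge0// ler1n.
have [->|t0] := eqVneq t 0%R.
  rewrite [X in _ <= X + _ + _](_ : _ = +oo); last by rewrite /log_singularity normr0 /lne lexx.
  rewrite [X in _ <= X + _]addye// addye ?leey//.
  by rewrite gt_eqF// (lt_le_trans _ (log_layers_ge0 _)).
have [->|tv0] := eqVneq (t + v)%R 0%R.
  have -> : log_layers (0 / d) = +oo.
    apply/eqP; rewrite -leye_eq; apply: le_trans (log_singularity_le_layers _).
    by rewrite mul0r /log_singularity normr0 /lne lexx.
  rewrite addey ?leey//.
  by rewrite /log_singularity lne_EFin ?normr_gt0// -EFinN -EFinD.
have nt0 : (0 < `|t|)%R by rewrite normr_gt0.
have ntv0 : (0 < `|t + v|)%R by rewrite normr_gt0.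
rewrite {1 2}/log_singularity !lne_EFin// -!EFinN -EFinD.
have [td|td] := leP (2 * d)%R `|t|%R.
  apply: (@le_trans _ _ (- ln `|t| + ln 2)%:E); last by rewrite leeDl// log_layers_ge0.
  have half : (`|t| / 2 <= `|t + v|)%R.
    have := ler_normB (t + v)%R v; rewrite addrK; lra.
  have : (ln `|t| <= ln 2 + ln `|t + v|)%R.
    by rewrite -lnM ?posrE// ler_ln ?posrE ?mulr_gt0//; lra.
  by rewrite lee_fin; lra.
apply: (@le_trans _ _ ((- ln `|t| + ln 2)%:E + log_singularity ((t + v) / d))); last first.
  by rewrite leeD2l// log_singularity_le_layers.
have ntvd : (0 < `|(t + v) / d|)%R by rewrite normr_gt0 mulf_neq0// invr_neq0// gt_eqF.
rewrite /log_singularity lne_EFin// -EFinN -EFinD lee_fin.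
rewrite normrM normfV (gtr0_norm d0) ln_div ?posrE//.
have : (ln `|t| <= ln 2 + ln d)%R.
  by rewrite -lnM ?posrE// ler_ln ?posrE ?mulr_gt0// ltW.
lra.
Qed.

Lemma measurable_near (d s rho : R) :
  measurable [set u | (`|s + clamp d u| <= rho)%R].
Proof.
rewrite (_ : [set _ | _] = (fun u => `|s + clamp d u|)%R @^-1` `]-oo, rho]).
  rewrite -[X in measurable X]setTI.
  have m : measurable_fun setT (fun u => `|s + clamp d u|)%R.
    apply: (measurableT_comp (@normr_measurable R setT)).
    by apply: measurable_funD => //; exact: measurable_clamp.
  exact: m.
by apply/seteqP; split => u /=; rewrite in_itv.
Qed.

Lemma uniform_near_le (d s rho : R) : (0 < d)%R -> (0 <= rho)%R ->
  uniform d [set u | (`|s + clamp d u| <= rho)%R] <= (2 * rho / d)%:E.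
Proof.
move=> d0 rho0; rewrite uniformE// mulrC EFinM.
apply: lee_wpmul2l; first by rewrite lee_fin invr_ge0 ltW.
apply: (@le_trans _ _ (lebesgueR `[(- s - rho)%R, (- s + rho)%R]%classic)).
  apply: le_measure; rewrite ?inE.
  - by apply: measurableI; [exact: measurable_near|exact: measurable_Icc].
  - exact: measurable_Icc.
  - move=> u [/=]; rewrite !in_itv/= => + ud; rewrite clamp_id// ler_norml; lra.
rewrite lebesgueR_Icc; last by lra.
by rewrite lee_fin; lra.
Qed.

Lemma measurable_log_layer (k : nat) :
  measurable_fun setT (fun s : R => ((`|s| <= q ^+ k)%R%:R : R)%:E).
Proof.
apply/measurable_EFinP.
rewrite (_ : (fun _ => _) = \1_[set s : R | (`|s| <= q ^+ k)%R]); last first.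
  apply/funext => s; rewrite indicE; congr (_%:R); congr nat_of_bool.
  by apply/idP/idP; rewrite inE.
apply: measurable_indic; rewrite (_ : [set _ | _] = (fun s : R => `|s|)%R @^-1` `]-oo, (q ^+ k)%R]).
  by rewrite -[X in measurable X]setTI; apply: (@normr_measurable R setT).
by apply/seteqP; split => s /=; rewrite in_itv.
Qed.

Lemma measurable_log_layers : measurable_fun setT log_layers.
Proof.
apply: ge0_emeasurable_sum => [k s _ _|k _]; first by rewrite lee_fin.
exact: measurable_log_layer.
Qed.

Definition layers_bound : R := (2 / (1 - q))%R.

(** Once the first coordinate of w is fixed, the k-th layer confines the second
    one to an interval of length 2 d q^k, of probability at most 2 q^k; these
    bounds form a geometric series. *)
Lemma integral_log_layers (d t : R) : (0 < d)%R ->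
  \int[uniform d \x uniform d]_w log_layers ((t + (clamp d w.1 - clamp d w.2)) / d)
  <= layers_bound%:E.
Proof.
move=> d0; pose s (w : R * R) : R := ((t + (clamp d w.1 - clamp d w.2)) / d)%R.
have ms : measurable_fun setT s.
  apply: measurable_funM => //; apply: measurable_funD => //; apply: measurable_funB.
    exact: (measurableT_comp (@measurable_clamp R d) measurable_fst).
  exact: (measurableT_comp (@measurable_clamp R d) measurable_snd).
have mlayer k : measurable_fun setT (fun w => ((`|s w| <= q ^+ k)%R%:R : R)%:E).
  exact: (measurableT_comp (measurable_log_layer k) ms).
rewrite integral_nneseries//.
have layer k : \int[uniform d \x uniform d]_w ((`|s w| <= q ^+ k)%R%:R : R)%:E
    <= (2 * q ^+ k)%:E.
  rewrite fubini_tonelli1//.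
  rewrite -(integral_cst_prob (uniform d) (2 * q ^+ k)).
  apply: ge0_subset_le_integral => // [x _|x _|x _].
  - by apply: integral_ge0 => y _; rewrite lee_fin.
  - by rewrite lee_fin mulr_ge0// exprn_ge0// ltW.
  rewrite /fubini_F; pose D := [set u | (`|- (t + clamp d x) + clamp d u| <= d * q ^+ k)%R].
  have DE y : ((`|s (x, y)| <= q ^+ k)%R%:R : R) = \1_D y.
    rewrite indicE; congr (_%:R); congr nat_of_bool.
    rewrite /s/= normrM normfV (gtr0_norm d0) ler_pdivrMr// mulrC -normrN.
    rewrite (_ : - (t + (clamp d x - clamp d y)) = - (t + clamp d x) + clamp d y)%R; last by ring.
    by apply/idP/idP; rewrite inE.
  under eq_integral => y _ do rewrite DE.
  rewrite integral_indic//; last exact: measurable_near.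
  rewrite setIT; apply: (le_trans (uniform_near_le _ d0 _)).
    by rewrite mulr_ge0 ?exprn_ge0// ltW.
  by rewrite /cst lee_fin mulrCA mulrAC mulfV ?mul1r// gt_eqF.
apply: (@le_trans _ _ (\sum_(0 <= k <oo) (2 * q ^+ k)%:E)).
  by apply: lee_nneseries => [k _ _|k _]; [apply: integral_ge0 => w _; rewrite lee_fin|exact: layer].
apply: lime_le.
  by apply: is_cvg_nneseries => k _ _; rewrite lee_fin mulr_ge0// exprn_ge0// ltW.
apply: nearW => n; rewrite sumEFin lee_fin -mulr_sumr /layers_bound ler_wpM2l//.
rewrite -[leRHS]mul1r ler_pdivlMr ?subr_gt0// mulrC big_mkord.
have -> : ((1 - q) * \sum_(i < n) q ^+ i = 1 - q ^+ n)%R.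
  by rewrite -opprB mulNr -subrX1 opprB.
by rewrite gerBl exprn_ge0// ltW.
Qed.

End logarithmic_singularity.

(** * Smoothing a product measure of bounded support *)

Section smoothing_limit.
Context {R : realType}.

Lemma jitter2_near (d : R) (z w : R * R) : (0 <= d)%R ->
  (`|(jitter2 d z w).1 - z.1| <= d)%R /\ (`|(jitter2 d z w).2 - z.2| <= d)%R.
Proof.
move=> d0; rewrite /jitter2/= !(addrC z.1) !(addrC z.2) !addrK.
have /andP[a0 ad] := clamp_ge0_le w.1 d0; have /andP[b0 bd] := clamp_ge0_le w.2 d0.
by rewrite !ger0_norm.
Qed.

Lemma cvg_smoothed_integrand (phi : R * R -> \bar R) (r : R * R -> R) (z : R * R) :
  measurable_fun setT phi -> (forall w, 0 <= phi w) ->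
  {for z, continuous r} -> (\forall w \near z, phi w = (r w)%:E) ->
  \int[uniform n.+1%:R^-1 \x uniform n.+1%:R^-1]_w phi (jitter2 n.+1%:R^-1 z w)
    @[n --> \oo] --> (r z)%:E.
Proof.
move=> mphi phi0 cr phir.
set I := fun n : nat => \int[_]_w _.
have sq (e : R) : (0 < e)%R ->
    \forall n \near \oo, (r z - e)%:E <= I n <= (r z + e)%:E.
  move=> e0.
  have : \forall w \near z, phi w = (r w)%:E /\ (`|r z - r w| < e)%R.
    by near=> w; split; near: w => //; move/cvgrPdist_lt: cr; exact.
  move=> /nbhs_ballP[del /= del0 H].
  have [N Nd] := exists_invn_lt del0.
  exists N => // n /= Nn; set d : R := (n.+1%:R^-1)%R.
  have d0 : (0 <= d)%R by rewrite invr_ge0.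
  have dd : (d < del)%R.
    by apply: le_lt_trans Nd; rewrite lef_pV2 ?posrE// ler_nat.
  have Hw w : phi (jitter2 d z w) = (r (jitter2 d z w))%:E /\ (`|r z - r (jitter2 d z w)| < e)%R.
    apply: H; have [s1 s2] := jitter2_near z w d0.
    by split; rewrite /ball/= distrC (le_lt_trans _ dd).
  pose U : probability (R * R)%type R := uniform d \x uniform d.
  have rz w : (r z - e <= r (jitter2 d z w) <= r z + e)%R.
    by have [_] := Hw w; rewrite ltr_norml => /andP[? ?]; apply/andP; split; lra.
  apply/andP; split.
    have [re|re] := leP (r z - e)%R 0%R.
      by apply: (@le_trans _ _ 0); [rewrite lee_fin|exact: integral_ge0].
    rewrite -(integral_cst_prob U); apply: ge0_subset_le_integral => // w _.
      by rewrite lee_fin ltW.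
    by have [-> _] := Hw w; rewrite lee_fin; have /andP[] := rz w.
  rewrite -(integral_cst_prob U); apply: ge0_subset_le_integral => // w _.
    have := phi0 (jitter2 d z w); have [-> _] := Hw w.
    by move=> /le_trans; apply; rewrite lee_fin; have /andP[] := rz w.
  by have [-> _] := Hw w; rewrite lee_fin; have /andP[] := rz w.
apply/fine_cvgP; split.
  have := sq 1%R ltr01; apply: filterS => n /andP[lo hi].
  by rewrite fin_numElt (lt_le_trans _ lo) ?ltNyr// (le_lt_trans hi) ?ltry.
apply/cvgrPdist_le => e e0; have := sq e e0; apply: filterS => n /andP[lo hi] /=.
have fin : I n \is a fin_num.
  by rewrite fin_numElt (lt_le_trans _ lo) ?ltNyr// (le_lt_trans hi) ?ltry.
move: lo hi; rewrite -(fineK fin) !lee_fin ler_norml => lo hi.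
by apply/andP; split; lra.
Unshelve. all: by end_near. Qed.

(** Testing against nonnegative functions is enough, since adding a constant to a
    bounded function changes all its means by this constant. *)
Lemma prob_plane_eventually (mu : prob_plane R) (mu_ : nat -> probability (R * R)%type R)
    (G : set (prob_plane R)) : nbhs mu G ->
  (forall f : R * R -> R, bounded_continuous f -> (forall z, 0 <= f z)%R ->
    \int[mu_ n]_z (f z)%:E @[n --> \oo] --> \int[mu : probability _ _]_z (f z)%:E) ->
  \forall n \near \oo, G (mu_ n).
Proof.
move=> /prob_plane_nbhs[k [f [e [fbc e0 fG]]]] cvg.
have each i : \forall n \near \oo,
    (`|(\int[mu_ n]_z f i z) - \int[mu : probability _ _]_z f i z| < e)%R.
  have [cf [M fM]] := fbc i.
  pose h z := (f i z + M)%R.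
  have h0 z : (0 <= h z)%R by have := fM z; rewrite ler_norml /h; lra.
  have hbc : bounded_continuous h.
    split; first by move=> z; apply: cvgD; [exact: cf|exact: cvg_cst].
    exists (M + `|M|)%R => z; rewrite (le_trans (ler_normD _ _))// lerD2r//.
  have hE (P : probability (R * R)%type R) :
      \int[P]_z (h z)%:E = ((\int[P]_z f i z)%R + M)%:E.
    have fint := bounded_integrable P (continuous_measurable2 cf) fM.
    have := integralD measurableT fint (@bounded_integrable _ _ R P (cst M) `|M|%R _ _).
    move=> /(_ _ _)/= -> //; rewrite integral_cst_prob EFinD /Rintegral fineK//.
    exact: integrable_fin_num fint.
  have := cvg h hbc h0; rewrite hE; under eq_fun do rewrite hE.
  move=> /fine_cvgP[_] /= /cvgrPdist_lt /(_ e e0); apply: filterS => n /=.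
  by rewrite opprD addrACA subrr addr0 distrC.
suff : \forall n \near \oo, forall i, (i < k)%N ->
    (`|(\int[mu_ n]_z f i z) - \int[mu : probability _ _]_z f i z| < e)%R.
  by apply: filterS => n; exact: fG.
elim: k {fG} => [|k ih]; first exact: nearW.
have := each k; move: ih; apply: filterS2 => n ih hk i.
by rewrite ltnS leq_eqVlt => /predU1P[->//|]; exact: ih.
Qed.

End smoothing_limit.

Section energy_smoothing.
Context {R : realType} (g : R * R -> R) (C : R).
Hypothesis g_cont : continuous g.
Hypothesis g_ge0 : forall z, (0 <= g z)%R.
Hypothesis g_le : forall z, (g z <= expR C)%R.
Variables (beta : R) (h : R * R -> R).
Hypothesis beta0 : (0 <= beta)%R.
Hypothesis h_cont : continuous h.
Hypothesis gh : forall z, neg_log g z = (h z)%:E + beta%:E * log_singularity (z.1 - z.2).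

Let g_meas : measurable_fun setT g := continuous_measurable2 g_cont.

Lemma neg_log_shift_le (M H d : R) (z w : R * R) : (0 < d)%R -> (d <= 1)%R ->
  (forall z, `|z.1| <= M + 1 -> `|z.2| <= M + 1 -> `|h z| <= H)%R ->
  (`|z.1| <= M)%R -> (`|z.2| <= M)%R ->
  neg_log g (jitter2 d z w) <= neg_log g z + (2 * H + beta * ln 2)%:E +
    beta%:E * log_layers ((z.1 - z.2 + (clamp d w.1 - clamp d w.2)) / d).
Proof.
move=> d0 d1 hH z1 z2.
have hz : (`|h z| <= H)%R by apply: hH; lra.
have [s1 s2] := jitter2_near z w (ltW d0).
have hs : (`|h (jitter2 d z w)| <= H)%R.
  apply: hH.
    by have := ler_normD ((jitter2 d z w).1 - z.1)%R z.1; rewrite subrK; lra.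
  by have := ler_normD ((jitter2 d z w).2 - z.2)%R z.2; rewrite subrK; lra.
have hsz : (h (jitter2 d z w) <= h z + 2 * H)%R.
  by move: hz hs; rewrite !ler_norml; lra.
set t := (z.1 - z.2)%R; set v := (clamp d w.1 - clamp d w.2)%R.
have vd : (`|v| <= d)%R.
  have /andP[? ?] := clamp_ge0_le w.1 (ltW d0); have /andP[? ?] := clamp_ge0_le w.2 (ltW d0).
  by rewrite ler_norml /v; apply/andP; split; lra.
have lay0 := log_layers_ge0 ((t + v) / d).
rewrite !gh (_ : (jitter2 d z w).1 - (jitter2 d z w).2 = t + v)%R; last by rewrite /jitter2/= /t /v; ring.
rewrite -/t; have [b0|bN0] := eqVneq beta 0%R.
  by rewrite b0 !mul0e !adde0 mul0r addr0 -EFinD lee_fin.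
have [t0|tN0] := eqVneq t 0%R.
  have bpos : (0 < beta)%R by rewrite lt_neqAle eq_sym bN0.
  have -> : log_singularity t = +oo by rewrite t0 /log_singularity normr0 /lne lexx.
  rewrite gt0_muley ?lte_fin// [X in _ <= X + _ + _]addey// [X in _ <= X + _]addye// addye ?leey//.
  by rewrite gt_eqF// (lt_le_trans _ (mule_ge0 _ lay0))// lee_fin.
have lt : log_singularity t = (- ln `|t|)%:E.
  by rewrite /log_singularity lne_EFin ?normr_gt0.
have := log_singularity_shift t d0 vd; rewrite lt -EFinD => /(@lee_wpmul2l _ beta%:E).
move=> /(_ beta0).
have bf : beta%:E \is a fin_num by [].
have df : (- ln `|t| + ln 2)%:E +? log_layers ((t + v) / d) by apply: fin_num_adde_defr.
rewrite (muleDr bf df) => hl; apply: (@le_trans _ _ ((h z + 2 * H)%:E + (beta%:E * (- ln `|t| + ln 2)%:E +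
    beta%:E * log_layers ((t + v) / d)))).
  by apply: leeD; [rewrite lee_fin|exact: hl].
rewrite addeA leeD2r// -!EFinM -!EFinD lee_fin; lra.
Qed.

(** The energies of all the smoothings of a point exceed the energy of the point
    by at most a constant, which makes them a dominated family. *)
Lemma smoothed_energy_le (M H d : R) (z : R * R) : (0 < d)%R -> (d <= 1)%R ->
  (forall z, `|z.1| <= M + 1 -> `|z.2| <= M + 1 -> `|h z| <= H)%R ->
  (`|z.1| <= M)%R -> (`|z.2| <= M)%R ->
  \int[uniform d \x uniform d]_w (neg_log g (jitter2 d z w) + C%:E) <=
  neg_log g z + C%:E + (2 * H + beta * ln 2 + beta * layers_bound)%:E.
Proof.
move=> d0 d1 hH z1 z2.
have [kz|] := ltP (neg_log g z) +oo; last first.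
  by rewrite leye_eq => /eqP ->; rewrite !addye// leey.
have [_ kE] := neg_log_fin kz; set r := (- ln (g z))%R in kE.
have H0 : (0 <= H)%R by have := hH z; move: (normr_ge0 (h z)) => ? ?; lra.
have rC : (0 <= r + C)%R by have := neg_log_ge g_le z; rewrite kE lee_fin; lra.
have ln20 : (0 <= ln 2 :> R)%R by rewrite ln_ge0// ler1n.
have bl0 : (0 <= beta * ln 2)%R by rewrite mulr_ge0.
pose c := (r + C + (2 * H + beta * ln 2))%R.
have c0 : (0 <= c)%R by rewrite /c; lra.
pose lay w := log_layers ((z.1 - z.2 + (clamp d w.1 - clamp d w.2)) / d).
have mlay : measurable_fun setT lay.
  apply: (measurableT_comp measurable_log_layers).
  apply: measurable_funM => //; apply: measurable_funD => //; apply: measurable_funB.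
    exact: (measurableT_comp (@measurable_clamp R d) measurable_fst).
  exact: (measurableT_comp (@measurable_clamp R d) measurable_snd).
pose U : probability (R * R)%type R := uniform d \x uniform d.
apply: (@le_trans _ _ (\int[U]_w (cst c%:E w + beta%:E * lay w))).
  apply: ge0_subset_le_integral => // w _.
  - by rewrite -leeBlDr// sub0e -EFinN neg_log_ge.
  - by rewrite adde_ge0 ?lee_fin// mule_ge0 ?lee_fin// log_layers_ge0.
  have := neg_log_shift_le w d0 d1 hH z1 z2; rewrite kE => /(leeD2r C%:E) /le_trans; apply.
  rewrite -EFinD addeAC -EFinD leeD2r// lee_fin /c; lra.
rewrite ge0_integralD//; last 2 first.
- by move=> w _; rewrite mule_ge0 ?lee_fin// log_layers_ge0.
- exact: measurable_funeM.
rewrite integral_cst_prob ge0_integralZl//; last by move=> w _; exact: log_layers_ge0.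
rewrite kE -!EFinD (_ : (r + C + _)%R = (c + beta * layers_bound)%R); last by rewrite /c; ring.
rewrite [leRHS]EFinD; apply: leeD2l; rewrite EFinM; apply: lee_wpmul2l; first by rewrite lee_fin.
exact: integral_log_layers.
Qed.

End energy_smoothing.

Section smoothing.
Context {R : realType}.

Lemma continuous_square_bounded (h : R * R -> R) (M : R) : continuous h ->
  exists H : R, forall z, (`|z.1| <= M -> `|z.2| <= M -> `|h z| <= H)%R.
Proof.
move=> ch; pose K := `[(- M)%R, M]%classic.
have Kc : compact (K `*` K) by apply: compact_setX; exact: segment_compact.
have : compact (h @` (K `*` K)).
  by apply: continuous_compact => //; exact: continuous_subspaceT.
move=> /compact_bounded[B [_ HB]]; exists (B + 1)%R => z z1 z2.
apply: (HB (B + 1)%R); first by rewrite ltrDl.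
by exists z => //; split; rewrite /K /= in_itv/= -ler_norml.
Qed.

Lemma cvg_integral_smoothed (m1 m2 : probability R R) (phi D : R * R -> \bar R) :
  measurable_fun setT phi -> (forall z, 0 <= phi z) ->
  {ae m1 \x m2, forall z,
    \int[uniform n.+1%:R^-1 \x uniform n.+1%:R^-1]_w phi (jitter2 n.+1%:R^-1 z w)
      @[n --> \oo] --> phi z} ->
  (m1 \x m2).-integrable setT D ->
  {ae m1 \x m2, forall z, forall n : nat,
    \int[uniform n.+1%:R^-1 \x uniform n.+1%:R^-1]_w phi (jitter2 n.+1%:R^-1 z w)
      <= D z} ->
  \int[smoothed m1 n.+1%:R^-1 \x smoothed m2 n.+1%:R^-1]_z phi z @[n --> \oo]
    --> \int[m1 \x m2]_z phi z.
Proof.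
move=> mphi phi0 cv iD le.
have [|||||_ _] := @dominated_convergence _ _ R (m1 \x m2) setT measurableT
  (fun (n : nat) z => \int[uniform n.+1%:R^-1 \x uniform n.+1%:R^-1]_w
     phi (jitter2 n.+1%:R^-1 z w)) phi D => //.
- by move=> n; exact: measurable_smoothed_integrand.
- by apply: filterS cv => z + _.
- apply: filterS le => z + n _; rewrite gee0_abs//; exact: integral_ge0.
rewrite (_ : [sequence _]_n = (fun n : nat =>
  \int[smoothed m1 n.+1%:R^-1 \x smoothed m2 n.+1%:R^-1]_z phi z))//.
by apply/funext => n; rewrite integral_smoothed.
Qed.

Lemma ae_square (m1 m2 : probability R R) (M : R) :
  m1 (~` `[(- M)%R, M]%classic) = 0 -> m2 (~` `[(- M)%R, M]%classic) = 0 ->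
  {ae m1 \x m2, forall z, (`|z.1| <= M)%R /\ (`|z.2| <= M)%R}.
Proof.
pose K : set R := `[(- M)%R, M]%classic; rewrite -!/K => K1 K2.
have mK : measurable (~` K) by apply: measurableC; exact: measurable_Icc.
apply: (@negligibleS _ _ _ _ ((~` K `*` setT) `|` (setT `*` ~` K))).
  move=> z /= zM; have [z1|z1] := lerP `|z.1|%R M; last first.
    left; split => //=; rewrite /K/= in_itv/= -ler_norml; apply/negP.
    by rewrite -ltNge.
  right; split => //=; rewrite /K/= in_itv/= -ler_norml => z2; exact: zM.
apply: negligibleU.
- exists (~` K `*` setT); split => //; first exact: measurableX.
  by rewrite [LHS](product_measure1E m1 m2)//= K1 mul0e.
- exists (setT `*` ~` K); split => //; first exact: measurableX.
  by rewrite [LHS](product_measure1E m1 m2)//= K2 mule0.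
Qed.

End smoothing.

Section smoothing_energy.
Context {R : realType} (g : R * R -> R) (C : R).
Hypothesis g_cont : continuous g.
Hypothesis g_ge0 : forall z, (0 <= g z)%R.
Hypothesis g_le : forall z, (g z <= expR C)%R.
Variables (beta : R) (h : R * R -> R).
Hypothesis beta0 : (0 <= beta)%R.
Hypothesis h_cont : continuous h.
Hypothesis gh : forall z, neg_log g z = (h z)%:E + beta%:E * log_singularity (z.1 - z.2).

Let g_meas : measurable_fun setT g := continuous_measurable2 g_cont.

Let mphi : measurable_fun setT (fun z => neg_log g z + C%:E).
Proof. exact: measurable_neg_log_shift. Qed.

Let phi0 z : 0 <= neg_log g z + C%:E.
Proof. exact: neg_log_shift_ge0. Qed.

(** Where the energy is finite g is positive, so that - ln g is continuous there
    and its local means converge; smoothed_energy_le dominates them. *)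
Lemma cvg_smoothed_energy (m1 m2 : probability R R) (M : R) :
  m1 (~` `[(- M)%R, M]%classic) = 0 -> m2 (~` `[(- M)%R, M]%classic) = 0 ->
  \int[m1 \x m2]_z (neg_log g z + C%:E) < +oo ->
  \int[smoothed m1 n.+1%:R^-1 \x smoothed m2 n.+1%:R^-1]_z (neg_log g z + C%:E)
    @[n --> \oo] --> \int[m1 \x m2]_z (neg_log g z + C%:E).
Proof.
move=> K1 K2 fin.
have aeM := ae_square K1 K2.
have iphi : (m1 \x m2).-integrable setT (fun z => neg_log g z + C%:E).
  apply/integrableP; split => //.
  by under eq_integral do rewrite gee0_abs//.
have [H hH] := continuous_square_bounded (M + 1) h_cont.
pose B := (2 * H + beta * ln 2 + beta * layers_bound)%R.
apply: (@cvg_integral_smoothed _ m1 m2 _ (fun z => neg_log g z + C%:E + B%:E)) => //.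
- have := integrable_ae measurableT iphi; apply: filterS => z /(_ I) phif.
  have kf : neg_log g z < +oo.
    rewrite ltey; apply: contraTneq phif => ->; by rewrite addye.
  have [gz kE] := neg_log_fin kf; rewrite kE -EFinD.
  apply: (@cvg_smoothed_integrand R _ (fun w => - ln (g w) + C)%R z mphi phi0).
    apply: cvgD; last exact: cvg_cst.
    apply: cvgN; apply: (@cvg_comp _ _ _ g (@ln R)); first exact: g_cont.
    exact: continuous_ln.
  have : \forall w \near z, (0 < g w)%R.
    by have := @g_cont z; move/cvgr_gt; apply.
  by apply: filterS => w gw; rewrite /neg_log lne_EFin.
- by apply: integrableD => //; exact: (@bounded_integrable _ _ R (m1 \x m2) (cst B) `|B|%R).
apply: filterS aeM => z [z1 z2] n.
apply: (smoothed_energy_le g_le beta0 gh _ _ hH) => //.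
by rewrite invf_le1// ler1n.
Qed.

Lemma exists_smoothing (m1 m2 : probability R R) (M : R) (G : set (prob_plane R)) (e : \bar R) :
  m1 (~` `[(- M)%R, M]%classic) = 0 -> m2 (~` `[(- M)%R, M]%classic) = 0 ->
  nbhs (m1 \x m2 : prob_plane R) G -> \int[m1 \x m2]_z (neg_log g z + C%:E) < e ->
  exists d : R, [/\ (0 < d)%R, G (smoothed m1 d \x smoothed m2 d) &
    \int[smoothed m1 d \x smoothed m2 d]_z (neg_log g z + C%:E) < e].
Proof.
move=> K1 K2 GP lte.
have fin := lt_le_trans lte (leey _).
have evG : \forall n \near \oo,
    G (smoothed m1 (n.+1%:R^-1 : R) \x smoothed m2 (n.+1%:R^-1 : R)).
  apply: (prob_plane_eventually GP) => f [cf [B fB]] f0.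
  have mf : measurable_fun setT (EFin \o f).
    by apply/measurable_EFinP; exact: continuous_measurable2.
  apply: (@cvg_integral_smoothed _ m1 m2 (EFin \o f) (cst B%:E)) => //.
  - suff cvf (z : R * R) :
        \int[uniform n.+1%:R^-1 \x uniform n.+1%:R^-1]_w (EFin \o f) (jitter2 n.+1%:R^-1 z w)
          @[n --> \oo] --> (EFin \o f) z by apply: aeW; exact: cvf.
    apply: (@cvg_smoothed_integrand R _ f z mf); [by move=> w; rewrite /= lee_fin|exact: cf|].
    apply: (@filterS _ (nbhs z) _ setT) => //; exact: filterT.
  - exact: (@bounded_integrable _ _ R (m1 \x m2) (cst B) `|B|%R).
  apply: aeW => z n.
  pose U : probability (R * R)%type R := uniform n.+1%:R^-1 \x uniform n.+1%:R^-1.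
  rewrite -[leRHS](integral_cst_prob U); apply: ge0_subset_le_integral => //= w _.
  - by rewrite lee_fin.
  - by rewrite lee_fin (le_trans _ (fB point)).
  by rewrite lee_fin (le_trans (ler_norm _)).
have evE := cvg_smoothed_energy K1 K2 fin (open_ereal_lt' lte).
have [n [Gn En]] := filter_ex (filterI evG evE).
by exists n.+1%:R^-1%R; split.
Qed.

End smoothing_energy.

(** * Truncation to a bounded support *)

Section truncation.
Context {R : realType}.

Lemma conditional_setC d (T : measurableType d) (m : {measure set T -> \bar R}) D
    (mD : measurable D) (p : R) :
  m D = p%:E -> (0 < p)%R -> conditional m mD (~` D) = 0.
Proof. by move=> Dp p0; rewrite (conditionalE mD _ Dp p0) setICl measure0 mule0. Qed.

Lemma integral_conditional_prod d1 d2 (T1 : measurableType d1) (T2 : measurableType d2)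
    (m1 : probability T1 R) (m2 : probability T2 R) D1 D2
    (mD1 : measurable D1) (mD2 : measurable D2) (p1 p2 : R) (phi : T1 * T2 -> \bar R) :
  m1 D1 = p1%:E -> (0 < p1)%R -> m2 D2 = p2%:E -> (0 < p2)%R ->
  measurable_fun setT phi -> (forall z, 0 <= phi z) ->
  \int[conditional m1 mD1 \x conditional m2 mD2]_z phi z =
  ((p1 * p2)^-1)%:E * \int[m1 \x m2]_(z in D1 `*` D2) phi z.
Proof.
move=> Dp1 p10 Dp2 p20 mphi phi0.
have mD : measurable (D1 `*` D2) by exact: measurableX.
have Dp : (m1 \x m2) (D1 `*` D2) = (p1 * p2)%:E.
  transitivity (m1 D1 * m2 D2); first exact: product_measure1E.
  by rewrite Dp1 Dp2.
rewrite -(integral_conditional mD Dp (mulr_gt0 p10 p20) mphi phi0).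
apply: eq_measure_integral => A mA _.
apply: (@product_measure_unique _ _ _ _ _ (conditional m1 mD1) (conditional m2 mD2)
  (conditional (m1 \x m2) mD)) => // A1 A2 mA1 mA2.
transitivity (((p1 * p2)^-1)%:E * (m1 \x m2) ((A1 `*` A2) `&` (D1 `*` D2))).
  by apply: conditionalE => //; exact: mulr_gt0.
transitivity ((p1^-1)%:E * m1 (A1 `&` D1) * ((p2^-1)%:E * m2 (A2 `&` D2))); last first.
  by congr (_ * _); apply/esym; exact: conditionalE.
rewrite -setXI [X in _ * X](_ : _ = m1 (A1 `&` D1) * m2 (A2 `&` D2)); last first.
  by apply: product_measure1E; exact: measurableI.
by rewrite invfM EFinM muleACA.
Qed.

Definition window n : set R := `[(- n.+1%:R)%R, n.+1%:R%R]%classic.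

Lemma measurable_window n : measurable (window n).
Proof. exact: measurable_Icc. Qed.

Lemma nondecreasing_window : nondecreasing_seq window.
Proof.
move=> m n mn; apply/subsetPset => x; rewrite /window/= !in_itv/= -!ler_norml.
by move=> /le_trans; apply; rewrite ler_nat.
Qed.

Lemma bigcup_window : \bigcup_n window n = setT.
Proof.
rewrite -subTset => x _; exists (Num.truncn `|x|%R) => //.
by rewrite /window/= in_itv/= -ler_norml ltW// truncnS_gt.
Qed.

Lemma cvg_window (m : probability R R) : m (window n) @[n --> \oo] --> 1.
Proof.
rewrite -(probability_setT m) -bigcup_window.
apply: nondecreasing_cvg_mu => //; last exact: nondecreasing_window.
- exact: measurable_window.
- by rewrite bigcup_window.
Qed.

Definition truncated (m : probability R R) n : probability R R :=
  conditional m (measurable_window n).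

Lemma cvg_integral_truncated (m1 m2 : probability R R) (phi : R * R -> \bar R) :
  measurable_fun setT phi -> (forall z, 0 <= phi z) ->
  \int[m1 \x m2]_z phi z < +oo ->
  \int[truncated m1 n \x truncated m2 n]_z phi z @[n --> \oo] -->
  \int[m1 \x m2]_z phi z.
Proof.
move=> mphi phi0 fin.
pose p1 n := fine (m1 (window n)); pose p2 n := fine (m2 (window n)).
have p1E n : m1 (window n) = (p1 n)%:E.
  by rewrite fineK// fin_num_measure//; exact: measurable_window.
have p2E n : m2 (window n) = (p2 n)%:E.
  by rewrite fineK// fin_num_measure//; exact: measurable_window.
have cp1 : p1 n @[n --> \oo] --> (1%R : R) by have /fine_cvgP[] := cvg_window m1.
have cp2 : p2 n @[n --> \oo] --> (1%R : R) by have /fine_cvgP[] := cvg_window m2.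
have p10 : \forall n \near \oo, (0 < p1 n)%R.
  by have := cp1; move/cvgr_gt; apply.
have p20 : \forall n \near \oo, (0 < p2 n)%R.
  by have := cp2; move/cvgr_gt; apply.
have cI : \int[m1 \x m2]_(z in window n `*` window n) phi z @[n --> \oo] -->
    \int[m1 \x m2]_z phi z.
  rewrite (_ : [set: R * R] = \bigcup_n (window n `*` window n)).
    apply: ge0_nondecreasing_set_cvg_integral => //.
    - move=> m n mn; apply/subsetPset => z [z1 z2].
      by split; move: z1 z2; have /subsetPset := nondecreasing_window mn; auto.
    - by move=> n; apply: measurableX; exact: measurable_window.
    - by move=> n; exact: measurable_funTS.
  apply/esym; rewrite -subTset => z _.
  have [i _ zi] : (\bigcup_n window n) z.1 by rewrite bigcup_window.
  have [j _ zj] : (\bigcup_n window n) z.2 by rewrite bigcup_window.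
  exists (maxn i j) => //; split.
    by have /subsetPset := nondecreasing_window (leq_maxl i j); exact.
  by have /subsetPset := nondecreasing_window (leq_maxr i j); exact.
have cp : ((p1 n * p2 n)^-1)%:E @[n --> \oo] --> (1 : \bar R).
  apply: cvg_EFin; first exact: nearW.
  have one : ((1 * 1 : R)^-1 = 1)%R by rewrite mulr1 invr1.
  rewrite -[X in _ --> X]one; apply: cvgV; first by rewrite mulr1 oner_neq0.
  exact: cvgM.
have I0 : 0 <= \int[m1 \x m2]_z phi z by exact: integral_ge0.
have fI : \int[m1 \x m2]_z phi z \is a fin_num by rewrite ge0_fin_numE.
have := cvgeM (mule_def_fin (isT : (1 : \bar R) \is a fin_num) fI) cp cI.
rewrite mul1e => /(_ _); apply: cvg_trans; apply: near_eq_cvg.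
near=> n; rewrite /truncated.
by rewrite (integral_conditional_prod (measurable_window n) (measurable_window n)
  (p1E n) _ (p2E n) _ mphi phi0)//; near: n.
Unshelve. all: by end_near. Qed.

Lemma exists_truncation (mu : prob_plane R) (m1 m2 : probability R R)
    (G : set (prob_plane R)) (phi : R * R -> \bar R) (e : \bar R) :
  (forall A, measurable A -> (mu : probability _ _) A = (m1 \x m2) A) ->
  nbhs mu G -> measurable_fun setT phi -> (forall z, 0 <= phi z) ->
  \int[mu : probability _ _]_z phi z < e ->
  exists (M : R) (n1 n2 : probability R R),
    [/\ n1 (~` `[(- M)%R, M]%classic) = 0, n2 (~` `[(- M)%R, M]%classic) = 0,
        G (n1 \x n2) & \int[n1 \x n2]_z phi z < e].
Proof.
move=> muE GP mphi phi0.
have intE f : \int[mu : probability _ _]_z f z = \int[m1 \x m2]_z f z.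
  by apply: eq_measure_integral => A mA _; exact: muE.
rewrite intE => lte.
have evG : \forall n \near \oo, G (truncated m1 n \x truncated m2 n).
  apply: (prob_plane_eventually GP) => f [cf [B fB]] f0; rewrite intE.
  apply: (@cvg_integral_truncated m1 m2 (EFin \o f)).
  - by apply/measurable_EFinP; exact: continuous_measurable2.
  - by move=> z; rewrite /= lee_fin.
  apply: (@le_lt_trans _ _ B%:E); last exact: ltry.
  pose U : probability (R * R)%type R := m1 \x m2.
  rewrite -[leRHS](integral_cst_prob U); apply: ge0_subset_le_integral => //= w _.
  - by rewrite lee_fin.
  - by rewrite lee_fin (le_trans _ (fB point)).
  by rewrite lee_fin (le_trans (ler_norm _)).
have evE := cvg_integral_truncated mphi phi0 (lt_le_trans lte (leey _)) (open_ereal_lt' lte).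
have pos (m : probability R R) : \forall n \near \oo, 0 < m (window n).
  exact: (cvg_window m (open_ereal_gt' lte01)).
have [n [[Gn En] [p1 p2]]] := filter_ex (filterI (filterI evG evE) (filterI (pos m1) (pos m2))).
exists n.+1%:R%R, (truncated m1 n), (truncated m2 n); split => //.
- apply: (@conditional_setC _ _ _ _ _ (fine (m1 (window n)))).
    by rewrite fineK// fin_num_measure//; exact: measurable_window.
  by rewrite fine_gt0// p1 /= (le_lt_trans (probability_le1 _ _)) ?ltry//; exact: measurable_window.
- apply: (@conditional_setC _ _ _ _ _ (fine (m2 (window n)))).
    by rewrite fineK// fin_num_measure//; exact: measurable_window.
  by rewrite fine_gt0// p2 /= (le_lt_trans (probability_le1 _ _)) ?ltry//; exact: measurable_window.
Qed.

End truncation.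

(** * Behaviour on the diagonal *)

Section diagonal.
Context {R : realType} (g : R * R -> R).
Hypothesis g_cont : continuous g.
Hypothesis g_ge0 : forall z, (0 <= g z)%R.
Variables (beta : R) (h : R * R -> R).
Hypothesis beta0 : (0 <= beta)%R.
Hypothesis h_cont : continuous h.
Hypothesis gh : forall x y : R, x != y ->
  (h (x, y))%:E = (beta * ln `|x - y|)%:E - lne (g (x, y))%:E.

Lemma neg_log_off_diagonal x y : x != y ->
  neg_log g (x, y) = (h (x, y) - beta * ln `|x - y|)%:E.
Proof.
move=> xy; have := gh xy; rewrite /neg_log; case: (lne (g (x, y))%:E) => [l||] //=.
by rewrite -EFinB => -[->]; congr (_%:E); rewrite addrAC subrr sub0r.
Qed.

Lemma gt0_off_diagonal x y : x != y ->
  (0 < g (x, y))%R /\ (g (x, y) * expR (h (x, y)) = expR (beta * ln `|x - y|))%R.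
Proof.
move=> xy; have kE := neg_log_off_diagonal xy.
have [|g0] := @neg_log_fin _ g (x, y); first by rewrite kE ltry.
rewrite kE => -[lE]; split => //.
by rewrite -[X in (X * _)%R](lnK (g0 : g (x, y) \is Num.pos)) -expRD; congr expR; lra.
Qed.

(** The continuous function g exp(h) equals t^beta at distance t from the
    diagonal, which determines its value on the diagonal. *)
Lemma approach_diagonal (x del : R) : (0 < del)%R ->
  exists2 e : R, (0 < e)%R & forall t, (0 < t)%R -> (t < e)%R ->
    (`|g (x, x) * expR (h (x, x)) - expR (beta * ln t)| < del)%R.
Proof.
move=> del0.
pose u z := (g z * expR (h z))%R.
have : {for (x, x), continuous u}.
  apply: cvgM; first exact: g_cont.
  by apply: (@cvg_comp _ _ _ h (@expR R)); [exact: h_cont|exact: continuous_expR].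
move=> /cvgrPdist_lt /(_ _ del0) /nbhs_ballP[e /= e0 H].
exists e => // t t0 te.
have xy : (x + t)%R != x by rewrite -subr_eq0 addrAC subrr add0r gt_eqF.
have [_] := gt0_off_diagonal xy; rewrite addrAC subrr add0r gtr0_norm// => <-.
apply: H; split; rewrite /ball/=; last by rewrite subrr normr0.
by rewrite opprD addNKr normrN gtr0_norm.
Qed.

(** On the diagonal both sides are h if beta = 0, and +oo if beta > 0, as t^beta
    then tends to 0. *)
Lemma neg_log_singularity z :
  neg_log g z = (h z)%:E + beta%:E * log_singularity (z.1 - z.2).
Proof.
case: z => x y /=; have [<-{y}|xy] := eqVneq x y; last first.
  rewrite (neg_log_off_diagonal xy) /log_singularity lne_EFin ?normr_gt0 ?subr_eq0//.
  by rewrite -EFinN -EFinM -EFinD mulrN.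
rewrite subrr; have -> : log_singularity (0%R : R) = +oo.
  by rewrite /log_singularity normr0 /lne lexx.
have u0 : (0 <= g (x, x) * expR (h (x, x)))%R by rewrite mulr_ge0// expR_ge0.
have [b0|bN0] := eqVneq beta 0%R.
  have uE : (g (x, x) * expR (h (x, x)) = 1)%R.
    apply/eqP; rewrite -subr_eq0 -normr_le0; apply/ler_addgt0Pr => e e0; rewrite add0r.
    have [b bpos /(_ (b / 2)%R)] := approach_diagonal x e0.
    rewrite divr_gt0// ltr_pdivrMr// ltr_pMr// ltr1n => /(_ isT isT).
    by rewrite b0 mul0r expR0 => /ltW.
  have gE : g (x, x) = expR (- h (x, x)) :> R.
    by rewrite expRN -[LHS](mulfK (lt0r_neq0 (expR_gt0 (h (x, x))))) uE mul1r.
  by rewrite b0 mul0e adde0 /neg_log gE lne_EFin ?expR_gt0// expRK EFinN oppeK.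
have bpos : (0 < beta)%R by rewrite lt_neqAle eq_sym bN0.
rewrite gt0_muley ?lte_fin// addey// /neg_log.
suff -> : g (x, x) = 0%R :> R by rewrite /lne lexx.
have : (g (x, x) * expR (h (x, x)) <= 0)%R.
  apply/ler_addgt0Pr => e e0; rewrite add0r.
  have e20 : (0 < e / 2)%R by rewrite divr_gt0.
  have [b b00 H] := approach_diagonal x e20.
  pose s := expR (ln (e / 2) / beta); pose t := (Num.min b s / 2)%R.
  have m0 : (0 < Num.min b s)%R by rewrite lt_min b00 expR_gt0.
  have t0 : (0 < t)%R by rewrite divr_gt0.
  have tm : (t < Num.min b s)%R by rewrite ltr_pdivrMr// ltr_pMr// ltr1n.
  have [tb te] : (t < b)%R /\ (t < s)%R by move: tm; rewrite lt_min => /andP.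
  have {}H := H t t0 tb.
  have : (expR (beta * ln t) <= e / 2)%R.
    rewrite -[leRHS](lnK (e20 : _ \is Num.pos)) ler_expR mulrC -ler_pdivlMr//.
    by rewrite -ler_expR lnK// ltW.
  by move: H; rewrite ltr_norml => /andP[] ? ? ?; lra.
move=> ule; have /eqP : (g (x, x) * expR (h (x, x)) = 0)%R by apply/eqP; rewrite eq_le ule.
by rewrite mulf_eq0 [X in _ || X]gt_eqF ?expR_gt0// orbF => /eqP.
Qed.

Lemma inf_neg_log_fin (C : R) : (forall z, g z <= expR C)%R ->
  inf_neg_log g \is a fin_num.
Proof.
move=> g_le; rewrite fin_numElt; apply/andP; split.
  apply: (@lt_le_trans _ _ (- C)%:E); first exact: ltNyr.
  by apply: le_ereal_inf_tmp => _ [z _ <-]; exact: neg_log_ge.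
apply: (@le_lt_trans _ _ (neg_log g (1, 0)%R)).
  by apply: ereal_inf_lbound; exists (1, 0)%R.
by rewrite neg_log_off_diagonal ?ltry// oner_neq0.
Qed.

End diagonal.

(** * Energy of a configuration *)

Section empirical_energy.
Context {R : realType} (g : R * R -> R) (C : R).
Hypothesis g_cont : continuous g.
Hypothesis g_ge0 : forall z, (0 <= g z)%R.
Hypothesis g_le : forall z, (g z + 1 <= expR C)%R.
Hypothesis I0_fin : inf_neg_log g \is a fin_num.

Let g_meas : measurable_fun setT g := continuous_measurable2 g_cont.

Let g_le' z : (g z <= expR C)%R.
Proof. by rewrite (le_trans _ (g_le z))// lerDl. Qed.

Let mphi : measurable_fun setT (fun z => neg_log g z + C%:E).
Proof. exact: measurable_neg_log_shift. Qed.

Let phi0 z : 0 <= neg_log g z + C%:E.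
Proof. exact: neg_log_shift_ge0. Qed.

Lemma weight_le_expR n (z : n.-tuple R * n.-tuple R) (s : R) :
  s%:E <= \sum_(p : 'I_n * 'I_n) neg_log g (tnth z.1 p.1, tnth z.2 p.2) ->
  (weight g z <= expR (- s))%R.
Proof.
rewrite /weight pair_big /=; set y := fun p : 'I_n * 'I_n => (tnth z.1 p.1, tnth z.2 p.2).
have [/existsP[p /eqP gp]|/existsPn gN0] := boolP [exists p, g (y p) == 0%R].
  by move=> _; rewrite (bigD1 p)//= [g _]gp mul0r expR_ge0.
have gp p : (0 < g (y p))%R by rewrite lt_neqAle eq_sym gN0 g_ge0.
rewrite (eq_bigr (fun p => (- ln (g (y p)))%:E)) => [|p _]; last first.
  by rewrite /neg_log lne_EFin ?gp.
rewrite sumEFin lee_fin => sle.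
have -> : (\prod_p g (y p))%R = expR (- \sum_p - ln (g (y p))).
  by rewrite -sumrN expR_sum; apply: eq_bigr => p _; rewrite opprK lnK// posrE.
by rewrite ler_expR lerN2.
Qed.

(** Empirical measures of configurations are product measures, so their rate is
    the average energy minus its infimum. *)
Lemma weight_le_of_rate n (z : n.+1.-tuple R * n.+1.-tuple R) (a : R) :
  a%:E < rate g (joint_empirical_measure z) ->
  (weight g z <= expR (- (n.+1%:R ^+ 2 * (a + fine (inf_neg_log g)))))%R.
Proof.
move=> /(lt_integral_of_rate g_cont g_le I0_fin (@joint_empirical_product _ _ z)).
rewrite integral_joint_empirical// -(fineK I0_fin) /= -!EFinD.
set N2 := (n.+1%:R ^+ 2 : R)%R; have N2p : (0 < N2)%R by rewrite exprn_gt0.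
rewrite lte_pdivlMl// big_split/= sumEFin sumr_const card_prod card_ord => H.
apply: weight_le_expR; rewrite -(@leeD2rE _ (N2 * C)%:E)//; apply: ltW; move: H.
rewrite -EFinM (_ : C *+ _ = N2 * C)%R; last by rewrite mulrC /N2 expr2 -natrM mulr_natr.
by rewrite -EFinD mulrDr.
Qed.

End empirical_energy.

(** * Lower bound on open sets *)

Section open_lower_bound.
Context {R : realType} (g : R * R -> R) (C : R).
Hypothesis g_cont : continuous g.
Hypothesis g_ge0 : forall z, (0 <= g z)%R.
Hypothesis g_le : forall z, (g z + 1 <= expR C)%R.
Variables (beta : R) (h : R * R -> R).
Hypothesis beta0 : (0 <= beta)%R.
Hypothesis h_cont : continuous h.
Hypothesis gh : forall z, neg_log g z = (h z)%:E + beta%:E * log_singularity (z.1 - z.2).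

Let g_meas : measurable_fun setT g := continuous_measurable2 g_cont.

Let g_le' z : (g z <= expR C)%R.
Proof. by rewrite (le_trans _ (g_le z))// lerDl. Qed.

Let mphi : measurable_fun setT (fun z => neg_log g z + C%:E).
Proof. exact: measurable_neg_log_shift. Qed.

Let phi0 z : 0 <= neg_log g z + C%:E.
Proof. exact: neg_log_shift_ge0. Qed.

(** Replace mu first by a truncation and then by a smoothing of it, both inside G
    and of energy still below - r. *)
Lemma weight_integral_open_ge (G : set (prob_plane R)) (mu : prob_plane R) nu (r : R) :
  open G -> G mu -> product_integrable g mu nu ->
  \int[mu : probability _ _]_z neg_log g z < (- r)%:E ->
  \forall n \near \oo, forall c : R, (0 <= c)%R ->
    (c * expR (n.+1%:R ^+ 2 * r))%:E <=
    \int[lebesgue_tuple n.+1 \x lebesgue_tuple n.+1]_(z in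
      joint_empirical_measure (n := n) @^-1` G) (c * weight g z)%:E.
Proof.
move=> oG Gmu [muE ik] lt.
have lt' : \int[mu : probability _ _]_z (neg_log g z + C%:E) < (C - r)%:E.
  by rewrite (integral_neg_log_shift _ ik) (addrC C) EFinD lteD2rE.
have [M [n1 [n2 [K1 K2 Gn En]]]] :=
  exists_truncation muE (open_nbhs_nbhs (conj oG Gmu)) mphi phi0 lt'.
have [d [d0 Gd Ed]] := exists_smoothing g_cont g_le' beta0 h_cont gh K1 K2
  (open_nbhs_nbhs (conj oG Gn)) En.
set s1 := smoothed n1 d in Gd Ed; set s2 := smoothed n2 d in Gd Ed.
have iks := integrable_neg_log g_cont g_le (lt_le_trans Ed (leey _)).
have Ek : \int[s1 \x s2]_z neg_log g z < (- r)%:E.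
  by move: Ed; rewrite (integral_neg_log_shift _ iks) (addrC C) EFinD lteD2rE.
have [k [f [e [fbc e0 fG]]]] := prob_plane_nbhs (open_nbhs_nbhs (conj oG Gd)).
have mf i := continuous_measurable2 (fbc i).1.
have fE i : \int[s1 \x s2]_z (f i z)%:E = ((\int[s1 \x s2]_z f i z)%R)%:E.
  have [_ [B fB]] := fbc i; rewrite /Rintegral fineK//.
  exact/integrable_fin_num/(bounded_integrable (s1 \x s2) (mf i) fB).
have d1 : (0 <= d^-1)%R by rewrite invr_ge0 ltW.
have s1d A : measurable A -> s1 A <= (d^-1)%:E * lebesgueR A by exact: smoothed_le.
have s2d A : measurable A -> s2 A <= (d^-1)%:E * lebesgueR A by exact: smoothed_le.
have := @weight_integral_ge _ g g_meas g_ge0 C g_le' s1 s2 _ k _ _ _ _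
  d1 s1d s2d mf (fun i => (fbc i).2) fE e0 iks Ek.
apply: filterS => n H c c0; apply: (le_trans (H c c0)).
apply: ge0_subset_le_integral => [z /= zG|z _|z _|z _ //].
- apply: fG => i ik'; have [_ [B fB]] := fbc i.
  by rewrite (Rintegral_joint_empirical z (mf i) fB); exact: zG.
- by rewrite lee_fin mulr_ge0// weight_ge0.
- by rewrite lee_fin mulr_ge0// weight_ge0.
Qed.

End open_lower_bound.

(** * The large deviation principle *)

Section dirac_product.
Context {R : realType}.

Lemma dirac_product (x y : R) (A : set (R * R)) : measurable A ->
  \d_(x, y) A = (\d_x \x \d_y) A :> \bar R.
Proof.
move=> mA; apply/esym; apply: (@product_measure_unique _ _ _ _ R
  (\d_x : probability _ _) (\d_y : probability _ _) (\d_(x, y) : probability _ _)) => //.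
move=> B1 B2 _ _; rewrite [LHS]diracE [X in X * _]diracE [X in _ * X]diracE in_setX -EFinM.
by case: (x \in B1); case: (y \in B2); rewrite /= ?mulr0 ?mulr1 ?mul0r.
Qed.

Lemma product_integrable_dirac (g : R * R -> R) (x y : R) : measurable_fun setT g ->
  neg_log g (x, y) \is a fin_num ->
  product_integrable g (\d_(x, y) : probability _ _)
    ((\d_x : probability R R), (\d_y : probability R R)).
Proof.
move=> mg fin; split => [A mA|]; first exact: dirac_product.
apply/integrableP; split; first exact: measurable_neg_log.
rewrite integral_dirac//; last by apply: measurableT_comp => //; exact: measurable_neg_log.
by rewrite diracT mul1e -ge0_fin_numE// abse_fin_num.
Qed.

End dirac_product.

Section exponential_scale.
Context {R : realType}.

Lemma lne_scaled_le (N s : R) (p : \bar R) : (0 < N)%R ->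
  p <= (expR (N * s))%:E -> (N^-1)%:E * lne p <= s%:E.
Proof.
move=> N0; rewrite lee_pdivrMl// -EFinM; case: p => [p||] //; last by rewrite le0_lneNy ?leNye.
have [p0 _|p0] := leP p 0%R; first by rewrite le0_lneNy ?leNye.
by rewrite lne_EFin// !lee_fin => pe; rewrite -ler_expR lnK.
Qed.

Lemma lne_scaled_ge (N s : R) (p : \bar R) : (0 < N)%R ->
  (expR (N * s))%:E <= p -> s%:E <= (N^-1)%:E * lne p.
Proof.
move=> N0; rewrite lee_pdivlMl// -EFinM; case: p => [p||] //; last by move=> _; exact: leey.
rewrite lee_fin => pe; have p0 := lt_le_trans (expR_gt0 _) pe.
by rewrite lne_EFin// lee_fin -ler_expR lnK.
Qed.

Lemma limn_esup_le (u : nat -> \bar R) (l : R) :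
  (forall e, (0 < e)%R -> \forall n \near \oo, u n <= (l + e)%:E) ->
  limn_esup u <= l%:E.
Proof.
move=> H; apply/lee_addgt0Pr => e e0; rewrite -EFinD.
apply: ereal_inf_le; exists (ereal_sup (u @` [set n | u n <= (l + e)%:E])).
  by exists [set n | u n <= (l + e)%:E] => //; exact: H.
by apply: ge_ereal_sup => _ [n /= un <-].
Qed.

Lemma limn_einf_ge (u : nat -> \bar R) (l : R) :
  (forall e, (0 < e)%R -> \forall n \near \oo, (l - e)%:E <= u n) ->
  l%:E <= limn_einf u.
Proof.
move=> H; rewrite /limn_einf leeNr -EFinN; apply: limn_esup_le => e /H.
by apply: filterS => n; rewrite -leeN2 -EFinN opprB addrC.
Qed.

Lemma le_oppe_real (x I : \bar R) :
  (forall s : R, s%:E < I -> x <= (- s)%:E) -> x <= - I.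
Proof.
case: I => [r||] H; last by rewrite /= leey.
  apply/lee_addgt0Pr => e e0; rewrite -EFinN -EFinD.
  by have := H (r - e)%R; rewrite lte_fin ltrBlDr ltrDl opprB addrC => /(_ e0).
case: x H => [x||] H //=.
  by have := H (1 - x)%R; rewrite ltry lee_fin opprB lerBrDr gerDl ler10 => /(_ isT).
by have := H 0%R; rewrite ltry leye_eq => /(_ isT).
Qed.

End exponential_scale.

Section partition_function_rate.
Context {R : realType} (g : R * R -> R) (C : R).
Hypothesis g_cont : continuous g.
Hypothesis g_ge0 : forall z, (0 <= g z)%R.
Hypothesis g_le : forall z, (g z + 1 <= expR C)%R.
Hypothesis g_pow : forall alpha : R, (0 < alpha)%R -> (alpha <= 1)%R ->
  \int[lebesgueR \x lebesgueR]_z (g z `^ alpha)%:E < +oo.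
Variables (beta : R) (h : R * R -> R).
Hypothesis beta0 : (0 <= beta)%R.
Hypothesis h_cont : continuous h.
Hypothesis gh : forall z, neg_log g z = (h z)%:E + beta%:E * log_singularity (z.1 - z.2).
Hypothesis I0_fin : inf_neg_log g \is a fin_num.

Let g_meas : measurable_fun setT g := continuous_measurable2 g_cont.

Let g_le' z : (g z <= expR C)%R.
Proof. by rewrite (le_trans _ (g_le z))// lerDl. Qed.

Let I0 : R := fine (inf_neg_log g).

Let inf_neg_log_le z : I0%:E <= neg_log g z.
Proof. by rewrite /I0 fineK//; apply: ereal_inf_lbound; exists z. Qed.

Lemma partition_function_le (r : R) : (- I0 < r)%R ->
  \forall n \near \oo, partition_function g n.+1 <= (expR (n.+1%:R ^+ 2 * r))%:E.
Proof.
move=> I0r.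
have [n z _|N _ HN] := @weight_integral_le _ g g_meas g_ge0 C I0 r (fun n => setT) g_pow g_le' _ I0r.
  apply: weight_le_expR => //.
  apply: (@le_trans _ _ (\sum_(p : 'I_n.+1 * 'I_n.+1) I0%:E)); last exact: lee_sum.
  by rewrite sumEFin sumr_const card_prod card_ord lee_fin mulrC expr2 -natrM mulr_natr.
exists N => // n Nn; have := HN n Nn 1%R ler01; rewrite mul1r.
by under eq_integral do rewrite mul1r.
Qed.

(** The lower bound on open sets, applied to the whole space and to the point
    mass at a place where neg_log g is close to its infimum. *)
Lemma partition_function_ge (r : R) : (r < - I0)%R ->
  \forall n \near \oo, (expR (n.+1%:R ^+ 2 * r))%:E <= partition_function g n.+1.
Proof.
move=> rI0.
have [_ [[x y] _ <-] kz] : exists2 e, range (neg_log g) e & e < (- r)%:E.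
  by apply: ereal_inf_lt; rewrite -/(inf_neg_log g) -(fineK I0_fin) lte_fin -/I0; lra.
have kf : neg_log g (x, y) \is a fin_num.
  by rewrite fin_numElt (lt_le_trans _ (inf_neg_log_le _)) ?ltNyr// (lt_trans kz) ?ltry.
have PI := product_integrable_dirac g_meas kf.
have [|N _ HN] := @weight_integral_open_ge _ g C g_cont g_ge0 g_le beta h beta0 h_cont gh
  setT _ _ r openT I PI.
  by rewrite integral_dirac//= ?diracT ?mul1e//; exact: measurable_neg_log.
exists N => // n Nn; have := HN n Nn 1%R ler01; rewrite mul1r preimage_setT.
by under eq_integral do rewrite mul1r.
Qed.

Lemma gibbs_le (F : set (prob_plane R)) (s e : R) : (0 < e)%R ->
  (forall mu, F mu -> s%:E < rate g mu) ->
  \forall n \near \oo, gibbs g (joint_empirical_measure (n := n) @^-1` F) <=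
    (expR (n.+1%:R ^+ 2 * (- s + e)))%:E.
Proof.
move=> e0 Fs; have e20 : (0 < e / 2)%R by rewrite divr_gt0.
have r1 : (- I0 - e / 2 < - I0)%R by rewrite ltrBlDr ltrDl.
have r2 : (- I0 < - I0 + e / 2)%R by rewrite ltrDl.
have r3 : (- (s + I0) < - (s + I0) + e / 2)%R by rewrite ltrDl.
have ub : \forall n \near \oo, forall c : R, (0 <= c)%R ->
    \int[lebesgue_tuple n.+1 \x lebesgue_tuple n.+1]_(z in
      joint_empirical_measure (n := n) @^-1` F) (c * weight g z)%:E <=
    (c * expR (n.+1%:R ^+ 2 * (- (s + I0) + e / 2)))%:E.
  apply: (@weight_integral_le _ g g_meas g_ge0 C (s + I0)%R _
    (fun n => joint_empirical_measure (n := n) @^-1` F)) => // n z Fz.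
  exact: (weight_le_of_rate g_cont g_ge0 g_le I0_fin (Fs _ Fz)).
have lo := partition_function_ge r1; have hi := partition_function_le r2.
apply: filterS3 lo hi ub => n Zlo Zhi H.
have Zfin : partition_function g n.+1 \is a fin_num.
  by rewrite fin_numElt (lt_le_trans _ Zlo) ?ltNyr// (le_lt_trans Zhi) ?ltry.
move: Zlo; rewrite -(fineK Zfin) lee_fin => Zlo.
have Z0 := lt_le_trans (expR_gt0 _) Zlo.
apply: (@le_trans _ _ ((fine (partition_function g n.+1))^-1 *
    expR (n.+1%:R ^+ 2 * (- (s + I0) + e / 2)))%:E).
  by apply: H; rewrite invr_ge0 ltW.
rewrite lee_fin ler_pdivrMl//; apply: le_trans (ler_wpM2r (expR_ge0 _) Zlo).
by rewrite -expRD ler_expR -mulrDr ler_wpM2l// ?exprn_ge0//; lra.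
Qed.

Lemma gibbs_ge (G : set (prob_plane R)) (mu : prob_plane R) (t e : R) : (0 < e)%R ->
  open G -> G mu -> rate g mu = t%:E ->
  \forall n \near \oo, (expR (n.+1%:R ^+ 2 * (- t - e)))%:E <=
    gibbs g (joint_empirical_measure (n := n) @^-1` G).
Proof.
move=> e0 oG Gmu rt; have e20 : (0 < e / 2)%R by rewrite divr_gt0.
have r1 : (- I0 - e / 2 < - I0)%R by rewrite ltrBlDr ltrDl.
have r2 : (- I0 < - I0 + e / 2)%R by rewrite ltrDl.
have [[nu PI]|] := pselect (exists nu, product_integrable g mu nu); last first.
  by move=> /not_product_integrable_rate; rewrite rt.
have kE : \int[mu : probability _ _]_z neg_log g z < (- (- (t + I0) - e / 2))%:E.
  have kf := integrable_fin_num measurableT PI.2.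
  have := product_integrable_rate PI; rewrite rt -(fineK I0_fin) -/I0 -(fineK kf).
  by rewrite -EFinB lte_fin => -[->]; lra.
have lb := weight_integral_open_ge g_cont g_ge0 g_le beta0 h_cont gh oG Gmu PI kE.
have lo := partition_function_ge r1; have hi := partition_function_le r2.
apply: filterS3 lo hi lb => n Zlo Zhi H.
have Zfin : partition_function g n.+1 \is a fin_num.
  by rewrite fin_numElt (lt_le_trans _ Zlo) ?ltNyr// (le_lt_trans Zhi) ?ltry.
move: Zlo Zhi; rewrite -(fineK Zfin) !lee_fin => Zlo Zhi.
have Z0 := lt_le_trans (expR_gt0 _) Zlo.
apply: (@le_trans _ _ ((fine (partition_function g n.+1))^-1 *
    expR (n.+1%:R ^+ 2 * (- (t + I0) - e / 2)))%:E); last first.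
  by apply: H; rewrite invr_ge0 ltW.
rewrite lee_fin ler_pdivlMl//; apply: (le_trans (ler_wpM2r (expR_ge0 _) Zhi)).
by rewrite -expRD ler_expR -mulrDr ler_wpM2l// ?exprn_ge0//; lra.
Qed.

End partition_function_rate.

Local Close Scope ereal_scope.

Theorem theorem1 (R : realType) (g : R * R -> R)
  (g_cont : continuous g)
  (g_ge0 : forall z, 0 <= g z)
  (g_pow : forall alpha : R, 0 < alpha -> alpha <= 1 ->
    (\int[lebesgueR \x lebesgueR]_z (g z `^ alpha)%:E < +oo)%E)
  (g_bnd : exists C : R, forall z, g z <= expR C)
  (g_cpt : forall a : R, 0 < a -> compact [set z | expR (- a) <= g z])
  (g_diag : exists2 beta : R, 0 <= beta &
    exists2 h : R * R -> R, continuous h &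
      forall x y : R, x != y ->
        (h (x, y))%:E = ((beta * ln `|x - y|)%:E - lne (g (x, y))%:E)%E) :
  large_deviation_principle (fun n => n.+1%:R ^+ 2 : R)
    (fun n => @gibbs R g n.+1) (@joint_empirical_measure R)
    (rate g).
Proof.
have [C0 gC0] := g_bnd; have [beta beta0 [h h_cont gh]] := g_diag.
pose C := ln (expR C0 + 1).
have g_le z : g z + 1 <= expR C by rewrite lnK ?lerD2r// posrE addr_gt0// expR_gt0.
have ks := neg_log_singularity g_cont g_ge0 beta0 h_cont gh.
have I0_fin := inf_neg_log_fin gh gC0.
have N0 n : 0 < n.+1%:R ^+ 2 :> R by rewrite exprn_gt0.
split.
- by move=> mu; exact: (rate_ge0 I0_fin).
- exact: (rate_lower_semicontinuous g_cont g_ge0 g_le I0_fin).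
- move=> F _; apply: le_oppe_real => s sI; apply: limn_esup_le => e e0.
  have Fs mu : F mu -> (s%:E < rate g mu)%E.
    by move=> Fmu; apply: (lt_le_trans sI); apply: ereal_inf_lbound; exists mu.
  have := gibbs_le g_cont g_ge0 g_le g_pow beta0 h_cont ks I0_fin e0 Fs.
  by apply: filterS => n; exact: lne_scaled_le.
- move=> G oG; rewrite leeNl; apply: le_ereal_inf_tmp => _ [mu Gmu <-].
  rewrite leeNl; case rt : (rate g mu) => [t||]; last 2 first.
  + by rewrite leNye.
  + by have := rate_ge0 I0_fin mu; rewrite rt.
  rewrite -EFinN; apply: limn_einf_ge => e e0.
  have := gibbs_ge g_cont g_ge0 g_le g_pow beta0 h_cont ks I0_fin e0 oG Gmu rt.
  by apply: filterS => n; exact: lne_scaled_ge.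
Qed.
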